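(* Let $q>2$ be a prime power, $n\ge 4$, and let $\Sigma$ be a canonical subgeometry of $\mathrm{PG}(n-1,q^n)$. Let $\Lambda$ be a line of $\mathrm{PG}(n-1,q^n)$ and $L$ a scattered linear set in $\Lambda\cong\mathrm{PG}(1,q^n)$. Then $L$ is a linear set of LP-type if and only if (i) there exists an $(n-3)$-subspace $\Gamma$ of $\mathrm{PG}(n-1,q^n)$ such that $\Gamma\cap\Sigma=\Gamma\cap\Lambda=\emptyset$ and $L=p_{\Gamma,\Lambda}(\Sigma)$; (ii) there exists a generator $\sigma$ of the subgroup of $\mathrm{P}\Gamma\mathrm{L}(n,q^n)$ fixing $\Sigma$ pointwise such that $\mathrm{intn}_\sigma(\Gamma)=2$; (iii) there exist a unique point $P\in\mathrm{PG}(n-1,q^n)$ and some point $Q$ such that $\Gamma=\langle P,P^{\sigma},\ldots,P^{\sigma^{n-4}},Q\rangle$; (iv) the line $\langle P^{\sigma^{n-1}},P^{\sigma^{n-3}}\rangle$ meets $\Gamma$.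
   Context: A canonical subgeometry of $\mathrm{PG}(n-1,q^n)=\mathrm{PG}(V,\mathbb{F}_{q^n})$ is a set $\{\langle u\rangle_{\mathbb{F}_{q^n}}: u\in S\setminus\{0\}\}$ where $S$ is an $n$-dimensional $\mathbb{F}_q$-subspace of $V$ spanning $V$ over $\mathbb{F}_{q^n}$. The subgroup of $\mathrm{P}\Gamma\mathrm{L}(n,q^n)$ fixing $\Sigma$ pointwise is cyclic of order $n$. The projection is $p_{\Gamma,\Lambda}(\Sigma)=\{\langle\Gamma,X\rangle\cap\Lambda : X\in\Sigma\}$. For a subspace $\Gamma$ of (projective) dimension $k$, $\mathrm{intn}_\sigma(\Gamma)$ is the least positive integer $r$ with $\dim(\Gamma\cap\Gamma^{\sigma}\cap\cdots\cap\Gamma^{\sigma^r})>k-2r$ (empty subspace has dimension $-1$). For a $2$-dimensional $\mathbb{F}_{q^n}$-space $W$, an $\mathbb{F}_q$-linear set of $\mathrm{PG}(W,\mathbb{F}_{q^n})$ of rank $\rho$ is $L_U=\{\langle u\rangle_{\mathbb{F}_{q^n}}: u\in U\setminus\{0\}\}$ for a $\rho$-dimensional $\mathbb{F}_q$-subspace $U$ of $W$; the weight of $\langle u\rangle$ is $\dim_{\mathbb{F}_q}(U\cap\langle u\rangle_{\mathbb{F}_{q^n}})$; $L_U$ is scattered if all points have weight one, maximum scattered if moreover it has rank $n$. Linear sets are equivalent if related by an element of $\mathrm{P}\Gamma\mathrm{L}(2,q^n)$. A linear set is of LP-type if it is equivalent to a maximum scattered linear set $L^n_{s,\delta}=\{\langle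 (x,\delta x^{q^s}+x^{q^{n-s}})\rangle_{\mathbb{F}_{q^n}}: x\in\mathbb{F}_{q^n}^*\}$ for some $\delta\in\mathbb{F}_{q^n}^*$ and $s$ with $\gcd(s,n)=1$.
   Formalization: L = p_{Γ,Λ}(Σ) is required only under some linear identification of Λ with PG(1,q^n), as the literal equality can fail when Λ meets Σ; uniqueness of P in (iii) is required only for n > 4, as for n = 4 every point of the line Γ qualifies. *)

(* Defs.v *)
From HB Require Import structures.
From mathcomp Require Import all_boot all_order all_algebra all_field.

Set Implicit Arguments.
Unset Strict Implicit.
Unset Printing Implicit Defensive.

Import Order.TTheory GRing.Theory Num.Theory.
Local Open Scope ring_scope.

(* Throughout, K plays the role of F_q and F that of F_{q^n}: K is a field and
   F a finite extension of K.  An F-vector space V is a [vectType F]; the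
   subspaces of PG(V,F) are the elements of [{vspace V}]. *)

(* [restr V] is V regarded as a vector space over K, so that [{vspace restr V}]
   is the type of the F_q-subspaces of V; compare [baseFieldType] in fieldext. *)
Section RestrictionOfScalars.

Variables (K : fieldType) (F : fieldExtType K) (V : vectType F).

Definition restr : Type := V.

HB.instance Definition _ := GRing.Zmodule.on restr.

Definition restr_scale (a : K) (u : restr) : restr := in_alg F a *: (u : V).

Fact restr_scaleA a b u :
  restr_scale a (restr_scale b u) = restr_scale (a * b) u.
Proof. by rewrite /restr_scale scalerA -rmorphM. Qed.

Fact restr_scale1 u : restr_scale 1 u = u.
Proof. by rewrite /restr_scale rmorph1 scale1r. Qed.

Fact restr_scaleDr a u v :
  restr_scale a (u + v) = restr_scale a u + restr_scale a v.
Proof. exact: scalerDr. Qed.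

Fact restr_scaleDl v a b :
  restr_scale (a + b) v = restr_scale a v + restr_scale b v.
Proof. by rewrite /restr_scale rmorphD scalerDl. Qed.

HB.instance Definition _ := GRing.Zmodule_isLmodule.Build K restr
  restr_scaleA restr_scale1 restr_scaleDr restr_scaleDl.

Lemma restr_scaleE (a : K) (u : V) :
  a *: (u : restr) = (a%:A : F) *: u :> V.
Proof. by []. Qed.

Let d := \dim {:F}.
Let bF : d.-tuple F := vbasis {:F}.
Let coordF (x : F) := coord_vbasis (memvf x).

Fact restr_vectMixin : Lmodule_hasFinDim K restr.
Proof.
pose bV := vbasis {:V}; set m := \dim {:V} in bV *.
pose v2r (x : restr) := mxvec (\matrix_(i, j) coord bF j (coord bV i (x : V))).
have v2r_lin : linear v2r.
  move=> a x y; rewrite -linearP; congr mxvec; apply/matrixP=> i j.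
  by rewrite !mxE linearP /= mulr_algl linearP.
pose r2v r : restr :=
  \sum_(i < m) (\sum_(j < d) vec_mx r i j *: bF`_j) *: bV`_i.
have v2rK : cancel v2r r2v.
  move=> x; transitivity (\sum_(i < m) coord bV i (x : V) *: bV`_i); last first.
    by rewrite -coord_vbasis ?memvf.
  apply: eq_bigr => i _; rewrite mxvecK; congr (_ *: _ : V).
  by rewrite (coordF (coord bV i _)); apply: eq_bigr => j _; rewrite mxE.
exists (m * d)%N, v2r => //; exists r2v => // r.
apply: (canLR vec_mxK); apply/matrixP=> i j; rewrite mxE.
by rewrite !coord_sum_free ?(basis_free (vbasisP _)).
Qed.

HB.instance Definition _ := restr_vectMixin.

Definition restr_basis (X : {vspace V}) : seq restr :=
  [seq (tnth bF ij.2 *: tnth (vbasis X) ij.1) | ij : 'I_(\dim X) * 'I_d].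

(* An F-subspace regarded as a K-subspace. *)
Definition restr_vspace (X : {vspace V}) : {vspace restr} :=
  <<restr_basis X>>%VS.

Let KZFZ a x (v : V) : a *: ((x *: v) : restr) = (a *: x) *: v :> V.
Proof. by rewrite restr_scaleE scalerA -scalerAl mul1r. Qed.

Lemma mem_restr_vspace (X : {vspace V}) (v : V) :
  ((v : restr) \in restr_vspace X) = (v \in X).
Proof.
apply/idP/idP=> [/coord_span->|/coord_vbasis->]; last first.
  apply: (@memv_suml K restr) => i _.
  rewrite (coordF (coord _ i v)) scaler_suml -/d.
  apply: (@memv_suml K restr) => j _.
  rewrite -/bF -KZFZ (@memvZ K restr) ?memv_span // -!tnth_nth.
  by apply/imageP; exists (i, j).
apply: (@memv_suml F V) => k _; rewrite nth_image; case: (enum_val k) => i j /=.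
by rewrite KZFZ memvZ ?vbasis_mem ?mem_tnth.
Qed.

End RestrictionOfScalars.

(* Semilinear maps and the collineations they induce; an element of
   PGammaL(V,F) is represented by any semilinear bijection inducing it. *)
Section Semilinear.

Variable F : fieldType.

Definition semilinear_bij (V W : vectType F) (f : V -> W) : Prop :=
  bijective f /\
  exists2 tau : {rmorphism F -> F}, bijective tau &
    forall (a : F) (u v : V), f (a *: u + v) = tau a *: f u + f v.

(* The image of a subspace under a semilinear map. *)
Definition imgv (V W : vectType F) (f : V -> W) (X : {vspace V}) : {vspace W} :=
  <<[seq f x | x <- vbasis X]>>%VS.

Lemma mem_imgv (V W : vectType F) (f : V -> W) (X : {vspace V}) (v : V) :
  semilinear_bij f -> (f v \in imgv f X) = (v \in X).
Proof.
case=> [[g fK gK] [tau [t tauK tK] fP]].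
have f0 : f 0 = 0.
  by have /eqP := fP 1 0 0; rewrite scaler0 addr0 rmorph1 scale1r -{1}[f 0]addr0
    (inj_eq (addrI _)) => /eqP.
have fsum n (a : 'I_n -> F) (w : 'I_n -> V) :
    f (\sum_i a i *: w i) = \sum_i tau (a i) *: f (w i).
  elim: n a w => [|n IHn] a w; first by rewrite !big_ord0.
  by rewrite !big_ord_recl fP IHn.
apply/idP/idP=> [|/coord_vbasis->].
  rewrite -[imgv f X]/(<<in_tuple [seq f x | x <- vbasis X]>>%VS).
  move=> /coord_span E; set c := coord _ in E.
  suff -> : v = \sum_i t (c i (f v)) *: (vbasis X)`_i.
    apply: memv_suml => i _; rewrite memvZ // vbasis_mem // mem_nth //.
    by rewrite -(size_map f).
  apply: (can_inj fK); rewrite fsum {1}E; apply: eq_bigr => i _.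
  by rewrite tK (nth_map 0) // -(size_map f).
rewrite fsum; apply: memv_suml => i _; rewrite memvZ // memv_span //.
by apply: map_f; rewrite mem_nth ?size_tuple.
Qed.

Variable V : vectType F.

(* Projective dimension; the empty subspace has dimension -1. *)
Definition pdim (X : {vspace V}) : int := (\dim X)%:Z - 1.

Definition intn_cond (sigma : V -> V) (G : {vspace V}) (r : nat) : bool :=
  (0 < r)%N &&
  (pdim G - (2 * r)%:Z < pdim (\bigcap_(i < r.+1) iter i (imgv sigma) G)%VS).

Lemma intn_ex (sigma : V -> V) (G : {vspace V}) : exists r, intn_cond sigma G r.
Proof.
exists (\dim G).+1; rewrite /intn_cond /pdim ltn0Sn /=.
set m := \dim (\bigcap_(_ < _) _)%VS; rewrite addrAC ltrD2r ltrBlDr -PoszD ltz_nat.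
by rewrite mul2n -addnn addnA ltn_addl // ltnS leq_addr.
Qed.

Definition intn (sigma : V -> V) (G : {vspace V}) : nat :=
  ex_minn (intn_ex sigma G).

(* Sets of points are predicates on subspaces, compared extensionally. *)
Definition fixes_pointwise (Sigma : {vspace V} -> Prop) (f : V -> V) : Prop :=
  semilinear_bij f /\ forall X, Sigma X -> imgv f X = X.

(* The collineation of sigma generates the pointwise stabilizer of Sigma. *)
Definition stabilizer_generator (Sigma : {vspace V} -> Prop) (sigma : V -> V)
    : Prop :=
  fixes_pointwise Sigma sigma /\
  forall f, fixes_pointwise Sigma f ->
    exists k : nat, forall X : {vspace V}, \dim X = 1%N ->
      imgv f X = iter k (imgv sigma) X.

Definition projection (G Lam : {vspace V}) (Sigma : {vspace V} -> Prop)
    : {vspace V} -> Prop :=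
  fun Y => exists2 X, Sigma X & Y = ((G + X) :&: Lam)%VS.

End Semilinear.

Section LinearSets.

Variables (K : fieldType) (F : fieldExtType K) (V : vectType F).

Definition points_of (U : {vspace restr V}) : {vspace V} -> Prop :=
  fun X => exists u : V, [/\ (u : restr V) \in U, u != 0 & X = <[u]>%VS].

Definition canonical_subgeometry (Sigma : {vspace V} -> Prop) : Prop :=
  exists S : {vspace restr V},
    [/\ \dim S = \dim {:V},
        forall W : {vspace V},
          (forall u : V, (u : restr V) \in S -> u \in W) -> W = fullv
      & forall X, Sigma X <-> points_of S X].

Definition weight (U : {vspace restr V}) (X : {vspace V}) : nat :=
  \dim (U :&: restr_vspace X).

Definition scattered (U : {vspace restr V}) : Prop :=
  forall X, points_of U X -> weight U X = 1%N.

Definition scattered_linear_set (L : {vspace V} -> Prop) : Prop :=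
  exists2 U : {vspace restr V}, scattered U & forall X, L X <-> points_of U X.

Definition maximum_scattered_linear_set (L : {vspace V} -> Prop) : Prop :=
  exists U : {vspace restr V},
    [/\ scattered U, \dim U = \dim {:F} & forall X, L X <-> points_of U X].

End LinearSets.

Section LPType.

Variables (K : finFieldType) (F : fieldExtType K).

Local Notation q := #|K|.

(* The vector space F^2 underlying PG(1,q^n). *)
Definition F2 : vectType F := (F^o * F^o)%type.

(* L^n_{s,delta} *)
Definition LP_set (n s : nat) (delta : F) : {vspace F2} -> Prop :=
  fun X => exists2 x : F, x != 0 &
    X = <[((x, delta * x ^+ (q ^ s) + x ^+ (q ^ (n - s)))%R : F2)]>%VS.

Definition equivalent (L M : {vspace F2} -> Prop) : Prop :=
  exists2 f : F2 -> F2, semilinear_bij f & forall X, L X <-> M (imgv f X).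

Definition LP_type (n : nat) (L : {vspace F2} -> Prop) : Prop :=
  exists s (delta : F),
    [/\ (0 < s < n)%N, coprime s n, delta != 0,
        maximum_scattered_linear_set (LP_set n s delta)
      & equivalent L (LP_set n s delta)].

End LPType.

Section Vertex.

Variables (F : fieldType) (V : vectType F).

(* G = < P, P^sigma, ..., P^(sigma^(n-4)), Q > for some point Q. *)
Definition spanned_from (n : nat) (sigma : V -> V) (G P : {vspace V}) : Prop :=
  exists2 Q : {vspace V}, \dim Q = 1%N &
    G = (\sum_(i < n - 3) iter i (imgv sigma) P + Q)%VS.

End Vertex.

(* Main.v *)
From HB Require Import structures.
Require Import Defs.
From mathcomp Require Import all_boot all_order all_algebra all_field.
From mathcomp Require Import fingroup perm cyclic zify ring.

Set Implicit Arguments.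
Unset Strict Implicit.
Unset Printing Implicit Defensive.

Import Order.TTheory GRing.Theory Num.Theory.
Local Open Scope ring_scope.

(** Write q = #|K|, and let sigma be the semilinear map acting on the coordinates
    with respect to a basis of the subgeometry as tau : x |-> x^(q^s); its fixed
    vectors form the K-space S of the subgeometry.  If the sigma-orbit of p is a
    basis of V, then S consists of the vectors whose coordinates in this basis are
    the successive tau-conjugates of one element x of F, and the subspace spanned
    by p, ..., p^(sigma^(n-4)) and a point of the line joining p^(sigma^(n-1)) and
    p^(sigma^(n-3)) is given by x = 0 and delta x^tau + x^(tau^-1) = 0 in these
    coordinates: projecting from it yields the LP-type set.

    Conversely, from the hypotheses on Gamma, if the orbit of p spans only a
    subspace of dimension r < n, then Gamma contains a point of the subgeometry for
    r = n - 3, and (ii), (iv) fail for r = n - 1.  For r = n - 2 the linear set has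
    a point of weight at least n - 2 with respect to S, and its size is then not of
    the form (q^rho - 1) / (q - 1), contradicting scatteredness; a similar count,
    on the points of a quadric, shows that S itself projects to a scattered
    space.  The counts need q > 2, as does the existence of a basis for which
    Gamma avoids the given line. *)

(** * Frobenius powers on a finite extension *)

(** The hypothesis on L provides some K-space U of unknown rank whose point set is L, while Sigma
    provides a second one, the image of S under the projection; nothing relates the two spaces
    beyond the equality of their point sets. So scatteredness enters only through the number of
    points: if the image of S is not scattered, the rank of U drops below n, and it remains to
    exhibit a number of points incompatible with that rank. In the other direction Lambda and L are
    prescribed, but the identification of Lambda with PG(1,q^n) is free, so any vertex of the right
    shape that is skew to Lambda will do. The freedom used to find one is the choice of a K-basis of
    F, that is, of a K-isomorphism from S to F. *)

Section Frobenius.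

Variables (K : finFieldType) (F : fieldExtType K).
Local Notation q := #|K|.
Local Notation n := (\dim {:F}).
Local Notation fF := (finvect_type F).
Implicit Types (x y : F) (i j : nat).

Definition fr j x : F := x ^+ (q ^ j).

Lemma card_ext : #|{: fF}| = (q ^ n)%N.
Proof.
have <- := @card_vspace K fF _ (fullv : {vspace fF}).
by apply: eq_card => x; rewrite memvf.
Qed.

Lemma q_gt1 : (1 < q)%N.
Proof. exact: finNzRing_gt1. Qed.

Lemma q_pchar j : [pchar F].-nat (q ^ j)%N.
Proof.
have [p pr_p pK] := finPcharP K.
rewrite pnatX; apply/orP; left.
have -> := card_pprimeChar pK; rewrite pnatX; apply/orP; left.
rewrite pnatE // (rmorph_pchar (in_alg F)) //.
Qed.

Lemma frD j : {morph fr j : x y / x + y}.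
Proof. by move=> x y; rewrite /fr exprDn_pchar ?q_pchar. Qed.

Fact fr_zmod j : zmod_morphism (fr j).
Proof.
move=> x y; apply/eqP; rewrite -(inj_eq (addIr (fr j y))) -frD !subrK; exact: eqxx.
Qed.

Fact fr_monoid j : monoid_morphism (fr j).
Proof. by split=> [|x y]; rewrite /fr ?expr1n ?exprMn. Qed.

HB.instance Definition _ j := GRing.isZmodMorphism.Build F F (fr j) (fr_zmod j).
HB.instance Definition _ j := GRing.isMonoidMorphism.Build F F (fr j) (fr_monoid j).

Lemma fr_comp i j x : fr i (fr j x) = fr (i + j) x.
Proof. by rewrite /fr -exprM -expnD addnC. Qed.

Lemma fr_id x : fr 0 x = x.
Proof. by rewrite /fr expn0 expr1. Qed.

Lemma fr_dim x : fr n x = x.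
Proof. by rewrite /fr -card_ext (@expf_card (FinFieldExtType F)). Qed.

Lemma fr_mod j x : fr (j %% n) x = fr j x.
Proof.
rewrite [in RHS](divn_eq j n) addnC; elim: (j %/ n)%N => [|k IHk]; first by rewrite addn0.
by rewrite mulSn addnCA -fr_comp -IHk fr_dim.
Qed.

Lemma fr_eqmod i j x : i = j %[mod n] -> fr i x = fr j x.
Proof. by move=> ij; rewrite -(fr_mod i) ij fr_mod. Qed.

Lemma fr_alg j (a : K) : fr j a%:A = a%:A.
Proof.
rewrite /fr -in_algE -rmorphXn /=; congr _%:A; elim: j => [|j IHj]; first by rewrite expr1.
by rewrite expnS mulnC exprM IHj expf_card.
Qed.

Lemma frZ j (a : K) x : fr j (a *: x) = a *: fr j x.
Proof. by rewrite -mulr_algl rmorphM /= fr_alg mulr_algl. Qed.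

Lemma n_gt0 : (0 < n)%N. Proof. exact: adim_gt0. Qed.

Lemma fr1_fixed x : fr 1 x = x -> exists a : K, x = a%:A.
Proof.
move=> fx; suff: x \in 1%VS by case/vlineP=> a ->; exists a.
by rewrite Fermat's_little_theorem dimv1; apply/eqP.
Qed.

(* Artin's independence of characters, by counting the roots of a q-polynomial. *)
Lemma fr_independent (c : nat -> F) :
  (forall x, \sum_(i < n) c i * fr i x = 0) -> forall i, (i < n)%N -> c i = 0.
Proof.
move=> c0 i lt_in; pose p : {poly F} := \sum_(i < n) c i *: 'X^(q ^ i).
have sz_p : (size p <= q ^ n)%N.
  apply: (leq_trans (size_sum _ _ _)); apply/bigmax_leqP => k _.
  apply: leq_trans (size_scale_leq _ _) _.
  by rewrite size_polyXn ltn_exp2l ?q_gt1.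
have p0 : p = 0.
  apply/eqP; apply: contraTT sz_p => nz_p; rewrite -ltnNge -card_ext cardE.
  apply: (@max_poly_roots F) => //; last exact: enum_uniq.
  apply/allP=> x _; rewrite rootE horner_sum -[X in _ == X](c0 x); apply/eqP.
  by apply: eq_bigr => k _; rewrite hornerZ hornerXn.
have := congr1 (coefp (q ^ i)) p0; rewrite /= coef0 coef_sum.
rewrite (bigD1 (Ordinal lt_in)) //= coefZ coefXn eqxx mulr1 big1 ?addr0 // => k neq_ki.
rewrite coefZ coefXn eqn_exp2l ?q_gt1 //; case: eqP => [eq_ik|]; last by rewrite mulr0.
by case/eqP: neq_ki; apply/val_inj.
Qed.

Lemma sum_delta (f : nat -> F) m i :
  (i < m)%N -> \sum_(k < m) (k == i :> nat)%:R * f k = f i.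
Proof.
move=> lt_im; rewrite (bigD1 (Ordinal lt_im)) //= eqxx mul1r big1 ?addr0 // => k.
by rewrite -val_eqE /= => /negbTE->; rewrite mul0r.
Qed.

Lemma fr_eq i j : (forall x, fr i x = fr j x) -> i = j %[mod n].
Proof.
move=> eq_ij; apply/eqP/negPn/negP=> neq_ij.
pose c (k : nat) : F := (k == i %% n)%N%:R - (k == j %% n)%N%:R.
have in_lt : (i %% n < n)%N by rewrite ltn_mod n_gt0.
have jn_lt : (j %% n < n)%N by rewrite ltn_mod n_gt0.
have: c (i %% n)%N = 0.
  apply: fr_independent => // x; under eq_bigr do rewrite mulrBl.
  by rewrite sumrB !(sum_delta (fun k => fr k x)) // !fr_mod eq_ij subrr.
by rewrite /c eqxx (negbTE neq_ij) subr0 => /eqP; rewrite oner_eq0.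
Qed.

Section Generator.

Variable s : nat.
Hypothesis co_sn : coprime s n.

Lemma coprime_invmod : exists t, (s * t)%N = 1 %[mod n].
Proof.
have s_gt0 : (0 < s)%N || (n == 1)%N.
  by case: s co_sn => //; rewrite /coprime gcd0n => ->; rewrite orbT.
case: (eqVneq n 1%N) => [->|n1]; first by exists 0%N; rewrite !modn1.
have{} s_gt0: (0 < s)%N by case: s co_sn n1 => //; rewrite /coprime gcd0n => ->.
case: (egcdnP n s_gt0) => km kn def_km _; exists km.
by rewrite mulnC def_km (eqP co_sn) modnMDl.
Qed.

Lemma fr_gen_fixed x : fr s x = x -> exists a : K, x = a%:A.
Proof.
move=> fx; have [t st1] := coprime_invmod; apply: fr1_fixed.
rewrite -(fr_eqmod x st1); elim: t {st1} => [|t IHt]; first by rewrite muln0 fr_id.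
by rewrite mulnS -fr_comp IHt.
Qed.

Lemma fr_gen_independent (c : nat -> F) :
  (forall x, \sum_(i < n) c i * fr (s * i) x = 0) -> forall i, (i < n)%N -> c i = 0.
Proof.
move=> c0 i lt_in; have [t st1] := coprime_invmod.
(* Multiplication by the inverse [t] of [s] permutes the residues mod n, so a sum over powers of tau
   is a rearranged sum over Frobenius powers. *)
pose h (i : 'I_n) : 'I_n := Ordinal (ltn_pmod (t * i) n_gt0).
have hinj : injective h.
  move=> a b /(congr1 val) /= /(congr1 (fun k : nat => ((s * k) %% n)%N)).
  rewrite !modnMmr !mulnA -modnMml st1 modnMml mul1n -[in RHS]modnMml st1 modnMml mul1n.
  by rewrite !modn_small // => ?; apply: val_inj.
have ti_s (k : nat) : (t * (s * k))%N = k %[mod n].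
  by rewrite mulnA (mulnC t) -modnMml st1 modnMml mul1n.
have st_i (k : nat) : (s * (t * k))%N = k %[mod n].
  by rewrite mulnA -modnMml st1 modnMml mul1n.
have lt_j : ((s * i) %% n < n)%N by rewrite ltn_mod n_gt0.
have c0' x : \sum_(j < n) c ((t * j) %% n)%N * fr j x = 0.
  rewrite -[RHS](c0 x) [RHS](reindex_inj hinj) /=; apply: eq_bigr => k _; congr (_ * _).
  by apply: fr_eqmod; rewrite modnMmr st_i.
have := @fr_independent (fun j => c ((t * j) %% n)%N) c0' _ lt_j; by rewrite modnMmr ti_s modn_small.
Qed.

End Generator.

(** Let [g] generate the multiplicative group of F. The product of the X - [fr i g] is invariant
    under Frobenius, which permutes its factors cyclically, so its coefficients lie in K and tau
    maps its root [g] to some [fr j g]; this determines tau on all powers of [g]. *)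
Lemma aut_fr (tau : {rmorphism F -> F}) :
  (forall a : K, tau a%:A = a%:A) -> exists2 j, (j < n)%N & forall x, tau x = fr j x.
Proof.
move=> tauK.
have [g gP] : exists g : F, forall x, x != 0 -> exists k : nat, x = g ^+ k.
  have /cyclicP[g gP] := @field_unit_group_cyclic (FinFieldExtType F) [set: _]%G.
  exists (FinRing.uval g) => x nz_x.
  have : @finField_unit (FinFieldExtType F) x nz_x \in <[g]>%g by rewrite -gP inE.
  case/cycleP=> k /(congr1 (@FinRing.uval _)) /= ->; exists k.
  by rewrite FinRing.val_unitX.
pose p : {poly F} := \prod_(i < n) ('X - (fr i g)%:P).
have pK i : exists a : K, p`_i = a%:A.
  apply: fr1_fixed; rewrite -coef_map rmorph_prod /=.
  suff -> : \prod_(i < n) map_poly (fr 1) ('X - (fr i g)%:P) = p by [].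
  rewrite /p -(big_mkord predT (fun i => map_poly (fr 1) ('X - (fr i g)%:P))).
  rewrite -(big_mkord predT (fun i => 'X - (fr i g)%:P)) -(prednK n_gt0).
  rewrite big_nat_recr // big_nat_recl //= mulrC; congr (_ * _).
    by rewrite rmorphB /= map_polyX map_polyC /= fr_comp add1n (prednK n_gt0) fr_dim fr_id.
  by apply: eq_bigr => k _; rewrite rmorphB /= map_polyX map_polyC /= fr_comp.
have root_tau : root p (tau g).
  have -> : p = map_poly tau p.
    by apply/polyP=> i; rewrite coef_map /=; have [a ->] := pK i; rewrite tauK.
  rewrite rmorph_root // /p rootE horner_prod (bigD1 (Ordinal n_gt0)) //=.
  by rewrite !hornerE fr_id subrr mul0r.
move: root_tau; rewrite rootE /p horner_prod; case/prodf_eq0=> j _.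
rewrite !hornerE subr_eq0 => /eqP tau_g; exists j => // x.
have [->|/gP[k ->]] := eqVneq x 0; first by rewrite !rmorph0.
by rewrite !rmorphXn /= tau_g.
Qed.

End Frobenius.

(** * Semilinear maps *)

Section SemilinearImages.

Variables (F : fieldType) (V : vectType F).
Implicit Types (X Y : {vspace V}).

Lemma imgvP (W : vectType F) (f : V -> W) X w :
  semilinear_bij f -> reflect (exists2 u, u \in X & w = f u) (w \in imgv f X).
Proof.
move=> hf; apply: (iffP idP) => [|[u Xu ->]]; last by rewrite mem_imgv.
have [[g fK gK] _] := hf; rewrite -{1}[w]gK mem_imgv // => Xgw.
by exists (g w); rewrite ?gK.
Qed.

Lemma imgv_line (W : vectType F) (f : V -> W) u :
  semilinear_bij f -> imgv f <[u]>%VS = <[f u]>%VS.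
Proof.
move=> hf; have [[g fK gK] [tau [t tauK tK] fP]] := hf.
have f0 : f 0 = 0.
  by apply: (addIr (f 0)); rewrite add0r -{1}[f 0]scale1r -(rmorph1 tau) -fP scale1r addr0.
have fZ a v : f (a *: v) = tau a *: f v by rewrite -[a *: v]addr0 fP f0 addr0.
apply/vspaceP=> w; apply/(imgvP _ _ hf)/vlineP=> [[v /vlineP[a ->] ->]|[a ->]].
  by exists (tau a).
by exists (t a *: u); rewrite ?memvZ ?memv_line // fZ tK.
Qed.

Lemma eq_semilinear_bij (W : vectType F) (f g : V -> W) :
  f =1 g -> semilinear_bij f -> semilinear_bij g.
Proof.
move=> fg [bij_f [tau tauB fP]]; split; first exact: eq_bij bij_f _ fg.
by exists tau => // a u v; rewrite -!fg.
Qed.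

Lemma eq_imgv (W : vectType F) (f g : V -> W) X : f =1 g -> imgv f X = imgv g X.
Proof. by move=> fg; rewrite /imgv (eq_map fg). Qed.

Lemma imgvS (W : vectType F) (f : V -> W) X Y :
  semilinear_bij f -> (X <= Y)%VS -> (imgv f X <= imgv f Y)%VS.
Proof.
move=> hf /subvP XY; apply/subvP=> w /(imgvP _ _ hf)[u Xu ->].
by rewrite mem_imgv ?XY.
Qed.

Lemma imgv_add (W : vectType F) (f : V -> W) X Y :
  semilinear_bij f -> imgv f (X + Y)%VS = (imgv f X + imgv f Y)%VS.
Proof.
move=> hf; have [_ [tau _ fP]] := hf.
apply/vspaceP=> w; apply/(imgvP _ _ hf)/memv_addP.
  case=> _ /memv_addP[u Xu [v Yv ->]] ->; exists (f u); first by rewrite mem_imgv.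
  by exists (f v); rewrite ?mem_imgv // -[u in LHS]scale1r fP rmorph1 scale1r.
case=> _ /(imgvP _ _ hf)[u Xu ->] [_ /(imgvP _ _ hf)[v Yv ->] ->].
by exists (u + v); rewrite ?memv_add // -[u in RHS]scale1r fP rmorph1 scale1r.
Qed.

Lemma imgv0 (W : vectType F) (f : V -> W) : imgv f 0%VS = 0%VS.
Proof.
rewrite /imgv; have -> : tval (vbasis (0%VS : {vspace V})) = [::].
  by apply: size0nil; rewrite size_tuple dimv0.
by rewrite span_nil.
Qed.

Lemma imgv_sum (W : vectType F) (f : V -> W) (I : Type) (r : seq I)
    (X : I -> {vspace V}) :
  semilinear_bij f -> imgv f (\sum_(i <- r) X i)%VS = (\sum_(i <- r) imgv f (X i))%VS.
Proof.
move=> hf; elim: r => [|i r IHr]; first by rewrite !big_nil imgv0.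
by rewrite !big_cons imgv_add ?IHr.
Qed.

Lemma dim_imgv_le (W : vectType F) (f : V -> W) X : (\dim (imgv f X) <= \dim X)%N.
Proof. by apply: leq_trans (dim_span _) _; rewrite size_map size_tuple. Qed.

Lemma semilinear_inv (W : vectType F) (f : V -> W) (g : W -> V) :
  semilinear_bij f -> cancel f g -> semilinear_bij g.
Proof.
case=> [[g' fK gK'] [tau [t tauK tK] fP]] fKg.
have gK : cancel g f by move=> w; rewrite -[w]gK' fKg.
split; first by exists f.
have tD : zmod_morphism t.
  by move=> a b; apply: (can_inj tauK); rewrite rmorphB /= !tK.
have tM : monoid_morphism t.
  by split=> [|a b]; apply: (can_inj tauK); rewrite ?rmorph1 ?rmorphM /= ?tK.
pose tZ := GRing.isZmodMorphism.Build F F t tD.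
pose tR := GRing.isMonoidMorphism.Build F F t tM.
pose tt : {rmorphism F -> F} := HB.pack t tZ tR.
exists tt; first by exists tau.
by move=> a u v; apply: (can_inj fKg); rewrite fP !gK /= tK.
Qed.

End SemilinearImages.

Lemma dim_imgv (F : fieldType) (V W : vectType F) (f : V -> W) (X : {vspace V}) :
  semilinear_bij f -> \dim (imgv f X) = \dim X.
Proof.
move=> hf; apply/eqP; rewrite eqn_leq dim_imgv_le /=.
have [[g fK gK] _] := hf; have hg := semilinear_inv hf fK.
suff {1}-> : X = imgv g (imgv f X) by apply: dim_imgv_le.
by apply/vspaceP=> u; rewrite -{2}[u]fK !mem_imgv.
Qed.

(** * Collineations acting by Frobenius powers on coordinates *)

Section CoordinatewiseFrobenius.

Variables (K : finFieldType) (F : fieldExtType K) (V : vectType F).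
Local Notation n := (\dim {:F}).
Variables (m : nat) (e : m.-tuple V).
Hypothesis eB : basis_of fullv e.
Implicit Types (u v : V) (i j : nat).

Definition sg j u : V := \sum_(i < m) fr j (coord e i u) *: e`_i.

Let eF : free e. Proof. exact: basis_free eB. Qed.

Lemma coord_sg j u (i : 'I_m) : coord e i (sg j u) = fr j (coord e i u).
Proof. by rewrite coord_sum_free. Qed.

Lemma coord_inj u v : (forall i : 'I_m, coord e i u = coord e i v) -> u = v.
Proof.
move=> uv; rewrite (coord_basis eB (memvf u)) (coord_basis eB (memvf v)).
by apply: eq_bigr => i _; rewrite uv.
Qed.

Lemma sgP j a u v : sg j (a *: u + v) = fr j a *: sg j u + sg j v.
Proof. by apply: coord_inj => i; rewrite linearP !coord_sg linearP rmorphD rmorphM /= !coord_sg. Qed.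

Lemma sgD j : {morph sg j : u v / u + v}.
Proof. by move=> u v; rewrite -[u]scale1r sgP rmorph1 !scale1r. Qed.

Lemma sg0 j : sg j 0 = 0.
Proof. by apply: coord_inj => i; rewrite coord_sg !linear0 rmorph0. Qed.

Lemma sgZ j a u : sg j (a *: u) = fr j a *: sg j u.
Proof. by rewrite -[a *: u]addr0 sgP sg0 addr0. Qed.

Lemma sg_sum j I (r : seq I) P (f : I -> V) :
  sg j (\sum_(i <- r | P i) f i) = \sum_(i <- r | P i) sg j (f i).
Proof. exact: (big_morph _ (sgD j) (sg0 j)). Qed.

Lemma sg_comp i j u : sg i (sg j u) = sg (i + j) u.
Proof. by apply: coord_inj => k; rewrite !coord_sg fr_comp. Qed.

Lemma sg_id u : sg 0 u = u.
Proof. by apply: coord_inj => k; rewrite !coord_sg fr_id. Qed.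

Lemma sg_eqmod i j u : i = j %[mod n] -> sg i u = sg j u.
Proof. by move=> ij; apply: coord_inj => k; rewrite !coord_sg (fr_eqmod _ ij). Qed.

Lemma sg_modl j u : sg (j * n) u = u.
Proof. by rewrite (@sg_eqmod _ 0) ?sg_id // modnMl mod0n. Qed.

Lemma sg_semilinear lam j : lam != 0 -> semilinear_bij (fun u => lam *: sg j u).
Proof.
move=> nz; split.
  (* [j * n - j] represents -j mod n for every natural j, because n is positive. *)
  exists (fun u => sg (j * n - j) (lam^-1 *: u)) => u.
    rewrite scalerK // sg_comp subnK ?sg_modl // leq_pmulr //; exact: n_gt0.
  rewrite sg_comp subnKC ?sg_modl ?scalerKV // leq_pmulr //; exact: n_gt0.
exists (fr j : {rmorphism F -> F}); last first.
  by move=> a u v; rewrite sgP scalerDr !scalerA mulrC.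
exists (fr (j * n - j)) => x.
  rewrite fr_comp subnK ?leq_pmulr ?n_gt0 // (@fr_eqmod _ _ _ 0) ?fr_id //.
  by rewrite modnMl mod0n.
rewrite /= fr_comp subnKC ?leq_pmulr ?n_gt0 // (@fr_eqmod _ _ _ 0) ?fr_id //.
by rewrite modnMl mod0n.
Qed.

Lemma sg_semilinear1 j : semilinear_bij (sg j).
Proof.
by apply: eq_semilinear_bij (sg_semilinear j (oner_neq0 F)) => u; rewrite scale1r.
Qed.

Lemma imgv_scale lam j X : lam != 0 -> imgv (fun u => lam *: sg j u) X = imgv (sg j) X.
Proof.
move=> nz; apply/vspaceP=> w.
apply/(imgvP _ _ (sg_semilinear j nz))/(imgvP _ _ (sg_semilinear1 j)) => -[u Xu ->].
  exists (fr (j * n - j) lam *: u); first by rewrite memvZ.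
  rewrite sgZ fr_comp subnKC ?leq_pmulr ?n_gt0 // (@fr_eqmod _ _ _ 0) ?fr_id //.
  by rewrite modnMl mod0n.
exists (fr (j * n - j) lam^-1 *: u); first by rewrite memvZ.
rewrite sgZ fr_comp subnKC ?leq_pmulr ?n_gt0 // (@fr_eqmod _ _ _ 0) ?fr_id ?scalerKV //.
by rewrite modnMl mod0n.
Qed.

(** Iterating the map multiplies vectors by a product of conjugates of [lam]; on subspaces this
    scalar disappears, so [lam] can be ignored from here on. *)
Lemma iter_imgv lam s k X :
  lam != 0 -> iter k (imgv (fun u => lam *: sg s u)) X = imgv (sg (s * k)) X.
Proof.
move=> nz; elim: k => [|k IHk].
  apply/vspaceP=> w; apply/idP/(imgvP _ _ (sg_semilinear1 _)) => [Xw|[u Xu ->]].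
    by exists w; rewrite ?muln0 ?sg_id.
  by rewrite muln0 sg_id.
rewrite iterS IHk (imgv_scale _ _ nz); apply/vspaceP=> w.
apply/(imgvP _ _ (sg_semilinear1 s))/(imgvP _ _ (sg_semilinear1 _)).
  by case=> _ /(imgvP _ _ (sg_semilinear1 _))[u Xu ->] ->; exists u; rewrite // sg_comp mulnS.
by case=> u Xu ->; exists (sg (s * k) u); rewrite ?mem_imgv ?sg_comp ?mulnS //; apply: sg_semilinear1.
Qed.

Local Opaque imgv sg.

(** * The pointwise stabilizer of the subgeometry *)

Section Subgeometry.

Variable Sigma : {vspace V} -> Prop.
Hypothesis SigmaP : forall X, Sigma X <-> exists u, [/\ u != 0, sg 1 u = u & X = <[u]>%VS].
Hypothesis m_gt1 : (1 < m)%N.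

Let two_ordinals : exists o l : 'I_m, l != o.
Proof. by exists (Ordinal (ltnW m_gt1)), (Ordinal m_gt1). Qed.

Lemma sg_fixed j u : sg 1 u = u -> sg j u = u.
Proof. by move=> fu; elim: j => [|j IHj]; rewrite ?sg_id // -addn1 -sg_comp fu. Qed.

Lemma sg_e j (i : 'I_m) : sg j e`_i = e`_i.
Proof. by apply: coord_inj => k; rewrite coord_sg !coord_free // rmorph_nat. Qed.

Lemma fixes_pointwise_scale_sg j lam : lam != 0 -> fixes_pointwise Sigma (fun u => lam *: sg j u).
Proof.
move=> nz; split; first exact: sg_semilinear.
by move=> X /SigmaP[u [nz_u fu ->]]; rewrite (imgv_scale _ _ nz) (imgv_line _ (sg_semilinear1 j)) sg_fixed.
Qed.

(** Fixing the points of e_o, e_i and e_o + b e_i, with b in K, forces equal multipliers on the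
    basis vectors and tau b = b. Two basis vectors are required for this, whence [m_gt1]; then
    [aut_fr] identifies tau. *)
Lemma fixes_pointwise_sg f : fixes_pointwise Sigma f ->
  exists j lam, [/\ (j < n)%N, lam != 0 & forall u, f u = lam *: sg j u].
Proof.
case=> hf fS; have [[g fK gK] [tau tauB fP]] := hf.
have fS1 u : sg 1 u = u -> exists c, f u = c *: u.
  move=> fu; have [->|nz_u] := eqVneq u 0.
    exists 0; apply: (addIr (f 0)).
    by rewrite scaler0 add0r -{1}[f 0]scale1r -(rmorph1 tau) -fP scale1r addr0.
  have SX : Sigma <[u]>%VS by apply/SigmaP; exists u.
  by apply/vlineP; rewrite -(fS _ SX) mem_imgv // memv_line.
have f0 : f 0 = 0 by have [|c ->] := fS1 0; rewrite ?sg0 ?scaler0.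
have fD u v : f (u + v) = f u + f v by rewrite -[u]scale1r fP rmorph1 !scale1r.
have fZ a u : f (a *: u) = tau a *: f u by rewrite -[a *: u]addr0 fP f0 addr0.
have [o [l neq_lo]] := two_ordinals.
have [lam lamP] := fS1 _ (sg_e 1 o).
have key (i : 'I_m) (a : K) : i != o -> f e`_i = lam *: e`_i /\ tau a%:A * lam = lam * a%:A.
  move=> neq_io; have [mu muP] := fS1 _ (sg_e 1 i).
  have hc (b : K) : tau b%:A * mu = lam * b%:A.
    have [|c cP] := fS1 (e`_o + b%:A *: e`_i); first by rewrite sgD sgZ !sg_e fr_alg.
    rewrite fD fZ lamP muP scalerDr !scalerA in cP.
    have := congr1 (coord e o) cP; have := congr1 (coord e i) cP.
    rewrite !linearD !linearZ /= !coord_free // !eqxx (negbTE neq_io).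
    have /negbTE-> : o != i by rewrite eq_sym.
    by rewrite !mulr0 !mulr1 !addr0 !add0r => -> ->.
  have mu_lam : mu = lam by have := hc 1; rewrite !scale1r rmorph1 mulr1 mul1r.
  by split; [rewrite muP mu_lam | rewrite -{1}mu_lam hc].
have nz_lam : lam != 0.
  have: e`_o != 0 by apply: (free_not0 eF); rewrite mem_nth ?size_tuple.
  apply: contra_neq => lam0; apply: (can_inj fK); by rewrite lamP lam0 scale0r f0.
have fe (i : 'I_m) : f e`_i = lam *: e`_i.
  by case: (eqVneq i o) => [->|neq_io]; last by case: (key i 0 neq_io).
have tauK (a : K) : tau a%:A = a%:A.
  have [_] := key l a neq_lo.
  by rewrite mulrC => /(mulfI nz_lam).
have [j lt_jn tauE] := aut_fr tauK.
exists j, lam; split=> // u; rewrite {1}(coord_basis eB (memvf u)) scaler_sumr.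
rewrite (big_morph _ fD f0); apply: eq_bigr => i _.
by rewrite fZ fe tauE scalerA mulrC -scalerA.
Qed.

Lemma sg_eq i j : (forall u, exists c, sg i u = c *: sg j u) -> i = j %[mod n].
Proof.
move=> H; apply: fr_eq => a.
have [o [l neq_lo]] := two_ordinals; have neq_ol : o != l by rewrite eq_sym.
have [c cP] := H (e`_o + a *: e`_l).
rewrite !sgD !sgZ !sg_e scalerDr scalerA in cP.
have := congr1 (coord e o) cP; have := congr1 (coord e l) cP.
rewrite !linearD !linearZ /= !coord_free // !eqxx (negbTE neq_lo) (negbTE neq_ol).
by rewrite !mulr0 !mulr1 !addr0 !add0r => -> <-; rewrite mul1r.
Qed.

Lemma stabilizer_generatorP f : stabilizer_generator Sigma f ->
  exists s lam, [/\ (s < n)%N, coprime s n, lam != 0 & f =1 fun u => lam *: sg s u].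
Proof.
case=> ff genf; have [s [lam [lt_sn nz_lam fE]]] := fixes_pointwise_sg ff.
exists s, lam; split=> //.
(* The Frobenius [sg 1] itself must be a power of [f], which makes [s] invertible mod n. *)
have [k kP] := genf _ (fixes_pointwise_scale_sg 1 (oner_neq0 F)).
have eq_img X : imgv f X = imgv (fun u => lam *: sg s u) X.
  exact: eq_imgv.
have it_img X : iter k (imgv f) X = imgv (sg (s * k)) X.
  rewrite -(iter_imgv s k X nz_lam); elim: k {kP} => //= k ->; exact: eq_img.
have sk1 : 1 = (s * k)%N %[mod n].
  apply: sg_eq => u; have [->|nz_u] := eqVneq u 0.
    by exists 0; rewrite !sg0 scaler0.
  have := kP <[u]>%VS; rewrite dim_vline nz_u => /(_ erefl).
  rewrite (imgv_scale _ _ (oner_neq0 F)) it_img !(imgv_line _ (sg_semilinear1 _)).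
  by move=> E; apply/vlineP; rewrite -E memv_line.
rewrite /coprime -dvdn1; have [d1 d2] := (dvdn_gcdl s n, dvdn_gcdr s n).
rewrite /dvdn -(modn_dvdm 1 d2) sk1 modn_dvdm // -/(dvdn _ _); exact: dvdn_mulr.
Qed.

Lemma sg_stabilizer_generator s : coprime s n -> stabilizer_generator Sigma (sg s).
Proof.
move=> co_sn; split.
  split; first exact: sg_semilinear1.
  move=> X /SigmaP[u [nz_u fu ->]]; by rewrite (imgv_line _ (sg_semilinear1 s)) sg_fixed.
move=> f /fixes_pointwise_sg[j [lam [lt_jn nz_lam fE]]].
have [t st1] := coprime_invmod co_sn; exists (t * j)%N => X _.
have -> : imgv f X = imgv (sg j) X.
  by rewrite -(imgv_scale j X nz_lam); apply: eq_imgv.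
have := iter_imgv s (t * j) X (oner_neq0 F).
have -> : iter (t * j) (imgv (fun u => 1 *: sg s u)) X = iter (t * j) (imgv (sg s)) X.
  elim: (t * j)%N => //= k ->.
  by apply: eq_imgv => u; rewrite scale1r.
move=> ->; apply: eq_imgv => u; apply: sg_eqmod.
by rewrite mulnA -modnMml st1 modnMml mul1n.
Qed.

End Subgeometry.

End CoordinatewiseFrobenius.

(** A K-basis of S spans V and has the right length, so it is an F-basis of V; then S consists of
    the vectors with coordinates in K, which are the Frobenius-fixed ones. *)
Lemma subgeometry_basis (K : finFieldType) (F : fieldExtType K) (V : vectType F)
    (S : {vspace restr V}) :
  \dim S = \dim {:V} ->
  (forall W : {vspace V}, (forall u : V, (u : restr V) \in S -> u \in W) -> W = fullv) ->
  exists e : (\dim S).-tuple V, basis_of fullv e /\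
    forall u : V, (u : restr V) \in S <-> sg e 1 u = u.
Proof.
move=> dimS spanS; pose e : (\dim S).-tuple V := vbasis S.
have eS : (<<e>> = fullv)%VS.
  apply: spanS => u uS; rewrite (@coord_vbasis K (restr V) u S uS).
  apply: (@memv_suml F V) => i _.
  rewrite restr_scaleE memvZ // memv_span // mem_nth // size_tuple; exact: ltn_ord.
have eB : basis_of fullv e by rewrite basisEdim eS subvv size_tuple dimS leqnn.
exists e; split=> // u; split=> [uS|fu].
  have uE := @coord_vbasis K (restr V) u S uS.
  have uE' : u = \sum_i (coord (vbasis S) i u)%:A *: e`_i by exact: uE.
  apply: (coord_inj eB) => i; rewrite (coord_sg eB) uE'.
  by rewrite coord_sum_free ?(basis_free eB) // fr_alg.
have -> : u = \sum_i coord e i u *: e`_i by exact: coord_basis eB (memvf u).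
apply: (@memv_suml K (restr V)) => i _.
have [a ->] : exists a : K, coord e i u = a%:A.
  by apply: fr1_fixed; rewrite -(coord_sg eB) fu.
by rewrite -restr_scaleE (@memvZ K (restr V)) // vbasis_mem // mem_nth // size_tuple.
Qed.

(** * Counting points of scattered linear sets *)

Lemma double_count (I J : finType) (A : {set I}) (B : {set J}) (R : I -> J -> bool) a b :
  (forall i, i \in A -> a <= #|[set j in B | R i j]|)%N ->
  (forall j, j \in B -> #|[set i in A | R i j]| <= b)%N ->
  (a * #|A| <= b * #|B|)%N.
Proof.
move=> hA hB; apply: (@leq_trans (\sum_(i in A) \sum_(j in B) R i j)).
  rewrite mulnC -sum_nat_const; apply: leq_sum => i /hA/leq_trans-> //.
  by rewrite -sum1dep_card -big_mkcondr /=; apply: eq_leq; apply: eq_bigr => j _.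
rewrite exchange_big /= mulnC -sum_nat_const; apply: leq_sum => j /hB; apply: leq_trans.
by rewrite -sum1dep_card -big_mkcondr /=; apply: eq_leq; apply: eq_bigr => i _.
Qed.

Lemma line_eq (F : fieldType) (W : vectType F) (u v : W) :
  u != 0 -> (<[u]> == <[v]>)%VS = (u \in <[v]>%VS).
Proof.
move=> nz_u; rewrite eqEdim !dim_vline nz_u -memvE; case: (u \in _) => //=.
by case: (v == 0).
Qed.

Section ScatteredCount.

Variables (K : finFieldType) (F : fieldExtType K) (W : vectType F).
Local Notation q := #|K|.
Variables (U : {vspace restr W}) (rho : nat).
Hypotheses (scU : scattered U) (dimU : \dim U = rho).
Local Notation fW := (finvect_type (restr W)).

Lemma card_vspace_set (T : vectType K) (X : {vspace T}) :
  #|[set x : finvect_type T | (x : T) \in X]| = (q ^ \dim X)%N.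
Proof.
pose f (c : {ffun 'I_(\dim X) -> K}) : finvect_type T := \sum_i c i *: (vbasis X)`_i : T.
have f_inj : injective f.
  move=> c c' /(congr1 (fun x : T => fun i => coord (vbasis X) i x)) E; apply/ffunP=> i.
  by move/(congr1 (fun h => h i)): E; rewrite /f !coord_sum_free ?(basis_free (vbasisP X)).
rewrite -[X in (_ ^ X)%N]card_ord -card_ffun -(card_imset _ f_inj).
apply: eq_card => x; rewrite inE; apply/idP/imsetP=> [Xx | [c _ ->]].
  exists [ffun i => coord (vbasis X) i x] => //; rewrite /f [LHS](coord_vbasis Xx).
  by apply: eq_bigr => i _; rewrite ffunE.
by apply: (@memv_suml K T) => i _; rewrite memvZ // vbasis_mem // mem_nth ?size_tuple.
Qed.

Lemma card_vspace_nz (T : vectType K) (X : {vspace T}) :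
  #|[set x : finvect_type T | (x \in X) && (x != 0)]| = (q ^ \dim X - 1)%N.
Proof.
rewrite -card_vspace_set [in RHS](cardsD1 (0 : finvect_type T)).
rewrite inE (mem0v X) add1n subn1 /=; apply: eq_card => x.
by rewrite !inE andbC.
Qed.

Let B : {set fW} := [set u : fW | ((u : restr W) \in U) && (u != 0)].

Lemma point_count Z : points_of U Z ->
  #|[set u in B | <[u : W]>%VS == Z]| = (q - 1)%N.
Proof.
move=> UZ; have := scU UZ; rewrite /weight => dim1.
have := card_vspace_nz (U :&: restr_vspace Z)%VS; rewrite dim1 expn1 => <-.
have [u0 [_ nz_u0 ->]] := UZ; apply: eq_card => u; rewrite !inE memv_cap.
case: (eqVneq (u : W) 0) => [-> | nz_u]; first by rewrite !andbF.
by rewrite !andbT mem_restr_vspace line_eq.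
Qed.

Section Family.

Variables (I : finType) (A : {set I}) (g : I -> W) (m : nat).

(** A scattered set of rank rho has (q ^ rho - 1) / (q - 1) points. This lemma and the next compare
    that number with a family of vectors; the denominator is cleared to stay within natural
    numbers. *)
Lemma scattered_count_ge :
  (forall i, i \in A -> points_of U <[g i]>%VS) ->
  (forall i, i \in A -> #|[set i' in A | <[g i']>%VS == <[g i]>%VS]| <= m)%N ->
  ((q - 1) * #|A| <= m * (q ^ rho - 1))%N.
Proof.
move=> Ug fib; rewrite -dimU -card_vspace_nz.
apply: (double_count (R := fun i (u : fW) => <[u : W]>%VS == <[g i]>%VS)) => [i Ai|u _].
  by rewrite point_count //; apply: Ug.
have [->|[i]] := set_0Vmem [set i in A | <[u : W]>%VS == <[g i]>%VS]; first by rewrite cards0.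
rewrite inE => /andP[Ai /eqP ui]; apply: leq_trans (fib i Ai).
by apply/subset_leq_card/subsetP=> k; rewrite !inE ui eq_sym.
Qed.

Lemma scattered_count_le :
  (forall Z, points_of U Z -> m <= #|[set i in A | <[g i]>%VS == Z]|)%N ->
  (m * (q ^ rho - 1) <= (q - 1) * #|A|)%N.
Proof.
move=> cov; rewrite -dimU -card_vspace_nz.
apply: (double_count (R := fun (u : fW) i => <[g i]>%VS == <[u : W]>%VS)) => [u|i Ai].
  by rewrite inE => /andP[Uu nz_u]; apply: cov; exists u.
have [->|[u]] := set_0Vmem [set u in B | <[g i]>%VS == <[u : W]>%VS]; first by rewrite cards0.
rewrite inE => /andP[]; rewrite inE => /andP[Uu nz_u] /eqP giu.
rewrite -(@point_count <[g i]>%VS).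
  by apply/subset_leq_card/subsetP=> k; rewrite !inE => /andP[-> /eqP->] /=.
by exists u.
Qed.

End Family.

Section LinearFamily.

Variables (T : vectType K) (S : {vspace T}) (g : T -> W) (d : nat).
Hypotheses (gZ : forall (k : K) x, g (k *: x) = k%:A *: g x)
  (dimS : \dim S = d)
  (UP : forall Z, points_of U Z <-> exists x, [/\ x \in S, x != 0 & Z = <[g x]>%VS]).
Local Notation fT := (finvect_type T).

Lemma line_gZ k x : k != 0 -> <[g (k *: x)]>%VS = <[g x]>%VS.
Proof.
move=> nz_k; apply/eqP; rewrite gZ eqEsubv -!memvE memvZ ?memv_line //=.
apply/vlineP; exists (k^-1)%:A; rewrite scalerA -scalerAl mul1r scalerA mulVf ?scale1r //.
Qed.

Lemma card_multiples (x : T) : x != 0 -> #|[set (k *: x : fT) | k in [set~ (0 : K)]]| = (q - 1)%N.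
Proof.
move=> nz_x; rewrite card_in_imset ?cardsC1 ?subn1 // => a b _ _ /eqP.
by rewrite -subr_eq0 -scalerBl scaler_eq0 (negbTE nz_x) orbF subr_eq0 => /eqP.
Qed.

(** Remove the K-multiples of [x1] from S: the remaining nonzero vectors still cover every point,
    the point of [x1] being covered by [x0], and they do so at least q - 1 times each. Hence q ^ rho
    - 1 is at most q ^ d - 1 - (q - 1). *)
Lemma nonscattered_rank x0 x1 : x0 \in S -> x0 != 0 -> x1 \in S -> x1 != 0 ->
  <[g x0]>%VS = <[g x1]>%VS -> (forall k : K, x0 != k *: x1) -> (rho < d)%N.
Proof.
move=> Sx0 nz0 Sx1 nz1 par ind.
pose M : {set fT} := [set (k *: x1 : fT) | k in [set~ (0 : K)]].
pose A : {set fT} := [set x : fT | ((x : T) \in S) && (x != 0)] :\: M.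
have MP x : reflect (exists2 k : K, k != 0 & x = k *: x1) (x \in M).
  apply: (iffP imsetP) => [[k]|[k nzk ->]]; first by rewrite !inE => nzk ->; exists k.
  by exists k; rewrite ?inE.
have cov x : x \in A -> (q - 1 <= #|[set y in A | <[g y]>%VS == <[g x]>%VS]|)%N.
  rewrite !inE => /and3P[Mx Sx nz_x].
  rewrite -(card_multiples nz_x); apply/subset_leq_card/subsetP=> _ /imsetP[k nzk ->].
  have nz_k : k != 0 by move: nzk; rewrite !inE.
  rewrite !inE line_gZ // eqxx andbT memvZ //= scaler_eq0 negb_or nz_k nz_x /= andbT.
  apply: contra Mx => /MP[l nzl E]; apply/MP; exists (k^-1 * l).
    by rewrite mulf_neq0 ?invr_eq0.
  by rewrite -scalerA -E scalerA mulVf ?scale1r.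
have x0A : (x0 : fT) \in A.
  by rewrite !inE Sx0 nz0 !andbT; apply/MP=> -[k _ E]; case/eqP: (ind k).
have leA : ((q - 1) * (q ^ rho - 1) <= (q - 1) * #|A|)%N.
  apply: (@scattered_count_le fT A g) => Z /UP[x [Sx nz_x ->]].
  case: (boolP ((x : fT) \in M)) => [/MP[k nzk ->]|nMx].
    by rewrite line_gZ // -par; apply: cov.
  by apply: cov; rewrite !inE nMx Sx.
have q1 := q_gt1 K.
have cA : (#|A| + (q - 1) = q ^ d - 1)%N.
  rewrite -dimS -card_vspace_nz -(card_multiples nz1) -/M.
  have sub : M \subset [set x : fT | ((x : T) \in S) && (x != 0)].
    apply/subsetP=> _ /MP[k nzk ->]; rewrite inE memvZ //= scaler_eq0 negb_or nzk; exact: nz1.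
  by rewrite cardsD (setIidPr sub) subnK // subset_leq_card.
rewrite leq_pmul2l ?subn_gt0 // in leA.
have: (q ^ rho < q ^ d)%N.
  have p1 : (0 < q ^ rho)%N by rewrite expn_gt0; lia.
  have p2 : (0 < q ^ d)%N by rewrite expn_gt0; lia.
  lia.
by rewrite ltn_exp2l.
Qed.

(** Otherwise rho is at most d - 1 by [nonscattered_rank], leaving at most (q ^ d.-1 - 1) / (q - 1)
    points; but q ^ d.-1 vectors, at most q - 1 on each point, yield more. *)
Lemma scattered_of_large (I : finType) (A : {set I}) (x : I -> T) :
  (forall i, i \in A -> x i \in S /\ x i != 0) ->
  (forall i, i \in A -> #|[set i' in A | <[g (x i')]>%VS == <[g (x i)]>%VS]| <= q - 1)%N ->
  (q ^ d.-1 <= #|A|)%N ->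
  forall x0 x1, x0 \in S -> x0 != 0 -> x1 \in S -> x1 != 0 ->
  <[g x0]>%VS = <[g x1]>%VS -> exists k : K, x0 = k *: x1.
Proof.
move=> Ax fib big x0 x1 Sx0 nz0 Sx1 nz1 par.
apply/exists_eqP; apply: contraT; rewrite negb_exists => /forallP ind.
have lt_rho := nonscattered_rank Sx0 nz0 Sx1 nz1 par ind.
have : ((q - 1) * #|A| <= (q - 1) * (q ^ rho - 1))%N.
  apply: (@scattered_count_ge I A (g \o x)) => //= i /Ax[Sx nz_x].
  by apply/UP; exists (x i).
have q1 := q_gt1 K.
rewrite leq_pmul2l ?subn_gt0 // => leA.
have : (q ^ rho <= q ^ d.-1)%N by rewrite leq_exp2l //; lia.
have p1 : (0 < q ^ rho)%N by rewrite expn_gt0; lia.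
lia.
Qed.

End LinearFamily.

End ScatteredCount.

(** * Scatteredness of LP-type sets *)

Section Trace.

Variables (K : finFieldType) (F : fieldExtType K).
Local Notation q := #|K|.
Local Notation n := (\dim {:F}).
Local Notation fF := (finvect_type F).

Definition ftr (x : F) : F := \sum_(i < n) fr i x.

Lemma ftrD : {morph ftr : x y / x + y}.
Proof. by move=> x y; rewrite -big_split; apply: eq_bigr => i _; rewrite rmorphD. Qed.

Lemma ftr0 : ftr 0 = 0.
Proof. by rewrite /ftr big1 // => i _; rewrite rmorph0. Qed.

Lemma ftrN x : ftr (- x) = - ftr x.
Proof. by apply: (addrI (ftr x)); rewrite -ftrD !subrr ftr0. Qed.

Lemma ftrZ (a : K) x : ftr (a *: x) = a *: ftr x.
Proof. by rewrite scaler_sumr; apply: eq_bigr => i _; rewrite frZ. Qed.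

Lemma ftr_fr j x : ftr (fr j x) = ftr x.
Proof.
elim: j => [|j IHj]; first by rewrite fr_id.
rewrite -[RHS]IHj -add1n -fr_comp; set y := fr j x.
rewrite /ftr -(big_mkord predT (fun i => fr i (fr 1 y))) -(big_mkord predT (fun i => fr i y)).
rewrite -(prednK (n_gt0 F)) big_nat_recr // [RHS]big_nat_recl //= addrC; congr (_ + _).
  by rewrite fr_comp addn1 (prednK (n_gt0 F)) fr_dim fr_id.
by apply: eq_bigr => i _; rewrite fr_comp addn1.
Qed.

Lemma ftr_nondegenerate c : (forall y, ftr (c * y) = 0) -> c = 0.
Proof.
move=> tr0; have [//|nz_c] := eqVneq c 0.
have t0 (x : F) : \sum_(i < n) 1 * fr i x = 0.
  by rewrite -[RHS](tr0 (c^-1 * x)) mulVKf //; apply: eq_bigr => i _; rewrite mul1r.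
have := @fr_independent _ F (fun=> 1) t0 0%N (n_gt0 F).
by move/eqP; rewrite oner_eq0.
Qed.

(* A nonzero quadratic form has at most 2 zeros on each line in the direction
   of a nonisotropic vector. *)
Lemma card_quadric s (w : F) :
  (exists x, ftr (w * (fr s x * x)) != 0) ->
  (#|[set x : fF | ftr (w * (fr s (x : F) * x)) == 0]%R| <= 2 * q ^ n.-1)%N.
Proof.
have algM (k : K) : (k * k)%:A = k%:A * k%:A :> F by rewrite -!in_algE rmorphM.
case=> a nz_a; pose Q x := ftr (w * (fr s x * x)).
pose Bil x := ftr (w * (fr s x * a + fr s a * x)).
have QE x (k : K) : Q (x + k *: a) = Q x + k *: Bil x + (k * k) *: Q a.
  rewrite /Q /Bil -!ftrZ -!ftrD; congr ftr.
  rewrite rmorphD /= frZ -[k *: a]mulr_algl -[k *: fr s a]mulr_algl.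
  by rewrite -[k *: (w * _)]mulr_algl -[(k * k) *: _]mulr_algl algM; ring.
(* Count pairs of a zero z and a vector x with z in x + K a: each z has q partners, and each x at
   most two, since Q restricted to x + K a is a quadratic polynomial with leading coefficient
   [Q a]. *)
suff: (q * #|[set x : fF | Q x == 0%R]| <= 2 * #|[set: fF]|)%N.
  rewrite cardsT card_ext -[X in (q ^ X)%N](prednK (n_gt0 F)) expnS mulnCA leq_pmul2l //.
  exact: ltnW (q_gt1 K).
have nz_aa : a != 0 by apply: contraNneq nz_a => ->; rewrite !mulr0 ftr0.
apply: (double_count (R := fun z (x : fF) => [exists k : K, z == x + k *: a])).
  move=> z _; have inj : injective (fun k : K => (z - k *: a : fF)).
    move=> k l /addrI/oppr_inj/eqP; rewrite -subr_eq0 -scalerBl scaler_eq0.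
    by rewrite (negbTE nz_aa) orbF subr_eq0 => /eqP.
  rewrite -(card_imset predT inj) subset_leq_card //; apply/subsetP=> _ /imsetP[k _ ->].
  by rewrite !inE; apply/existsP; exists k; rewrite subrK.
move=> x _; pose R := [set k : K | Q (x + k *: a) == 0].
apply: (@leq_trans #|R|).
  apply: leq_trans (leq_imset_card (fun k : K => (x + k *: a : fF)) R).
  apply/subset_leq_card/subsetP=> z; rewrite !inE => /andP[Qz /existsP[k /eqP zE]].
  by apply/imsetP; exists k; rewrite // inE -zE.
pose p : {poly F} := (Q a)%:P * 'X^2 + (Bil x)%:P * 'X + (Q x)%:P.
have nz_p : p != 0.
  apply: contraNneq nz_a => /(congr1 (coefp 2)).
  by rewrite /= !coefE /= mulr1 mulr0 !addr0 => E; apply/eqP.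
have sz_p : (size p <= 3)%N.
  rewrite (leq_trans (size_polyD _ _)) // geq_max (leq_trans (size_polyC_leq1 _)) // andbT.
  rewrite (leq_trans (size_polyD _ _)) // geq_max !mul_polyC.
  by rewrite !(leq_trans (size_scale_leq _ _)) ?size_polyXn ?size_polyX.
have := @max_poly_roots F p [seq in_alg F k | k <- enum R] nz_p.
rewrite size_map -cardE => bnd; rewrite -ltnS; apply: leq_trans sz_p; apply: bnd.
  apply/allP=> _ /mapP[k + ->]; rewrite mem_enum inE => /eqP Qk; apply/eqP.
  rewrite !hornerE /= -Qk QE -[k *: Bil x]mulr_algl -[_ *: Q a]mulr_algl algM.
  ring.
by rewrite map_inj_uniq ?enum_uniq //; exact: fmorph_inj.
Qed.

End Trace.

Section LPScattered.

Variables (K : finFieldType) (F : fieldExtType K) (W : vectType F).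
Local Notation q := #|K|.
Local Notation n := (\dim {:F}).
Local Notation fF := (finvect_type F).
Hypotheses (hq : (2 < q)%N) (hn : (2 < n)%N).
Variables (s : nat) (delta : F).
Hypotheses (co_sn : coprime s n) (lt_sn : (s < n)%N).

Definition lp (x : F) : F := delta * fr s x + fr (n - s) x.

Let wr (x y : F) := fr s x * y - fr s y * x.

Let fr_sn (x : F) : fr s (fr (n - s) x) = x.
Proof. by rewrite fr_comp subnKC ?fr_dim // ltnW. Qed.

Let fr_ns (x : F) : fr (n - s) (fr s x) = x.
Proof. by rewrite fr_comp subnK ?fr_dim // ltnW. Qed.

Let wr_parallel x y : x * lp y = y * lp x -> fr (n - s) (wr x y) = delta * wr x y.
Proof.
move=> E; rewrite rmorphB !rmorphM /= !fr_ns /wr.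
have /eqP : x * lp y - y * lp x = 0 by rewrite E subrr.
rewrite /lp => /eqP E'; apply/eqP; rewrite -subr_eq0; apply/eqP; rewrite -[RHS]E'; ring.
Qed.

Let wr_eq0 x y : y != 0 -> wr x y = 0 -> exists k : K, x = k *: y.
Proof.
move=> nz_y /eqP; rewrite subr_eq0 => /eqP E.
have [|k kE] := @fr_gen_fixed _ _ _ co_sn (x / y).
  rewrite rmorphM fmorphV /=; apply: (mulIf nz_y); rewrite divfK //.
  by rewrite mulrAC E mulrAC mulfV ?mul1r ?fmorph_eq0.
by exists k; rewrite -mulr_algl -kE divfK.
Qed.

Let s_gt0 : (0 < s)%N.
Proof. by case: s co_sn => //; rewrite /coprime gcd0n; move: hn; case: n => [|[|]]. Qed.

Let s_neq : s <> (n - s)%N.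
Proof.
move=> E; have nE : (n = 2 * s)%N by lia.
move: co_sn hn; rewrite nE /coprime gcdnMl => /eqP->; lia.
Qed.

(** If the form vanished, so would its polarization, giving w x^tau + (w x)^(tau^-1) = 0 for all x.
    As tau and tau^-1 are different Frobenius powers by [s_neq], independence gives w = 0. *)
Let quadric_nz (w : F) : w != 0 -> exists x : F, ftr (w * (fr s x * x)) != 0.
Proof.
move=> nz_w.
case: (boolP [exists x : fF, ftr (w * (fr s (x : F) * x)) != 0]) => [/existsP[x xP]|].
  by exists x.
rewrite negb_exists => /forallP noQ; case/eqP: nz_w.
have Q0 (x : F) : ftr (w * (fr s x * x)) = 0 by apply/eqP; have := noQ x; rewrite negbK.
have pol x : w * fr s x + fr (n - s) (w * x) = 0.
  apply: ftr_nondegenerate => y.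
  have := Q0 (x + y); rewrite rmorphD /=.
  have -> : w * ((fr s x + fr s y) * (x + y)) =
    w * (fr s x * x) + w * (fr s y * y) + (w * fr s x * y + (w * x) * fr s y) by ring.
  rewrite 2!ftrD !Q0 !add0r ftrD -(ftr_fr (n - s) (w * x * _)) rmorphM /= fr_ns -ftrD.
  by rewrite -mulrDl.
pose c (i : nat) : F := (i == s)%:R * w + (i == n - s)%N%:R * fr (n - s) w.
have := @fr_independent _ F c _ s lt_sn; rewrite /c eqxx mul1r.
have /eqP/negbTE-> := s_neq; rewrite mul0r addr0; apply=> x.
rewrite -[RHS](pol x) rmorphM /=.
under eq_bigr do rewrite mulrDl -!mulrA.
rewrite big_split /= (sum_delta (fun i => w * fr i x)) //.
by rewrite (sum_delta (fun i => fr (n - s) w * fr i x)) //; have := s_gt0; lia.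
Qed.

Variables (U : {vspace restr W}) (g : F -> W).
Hypotheses (scU : scattered U)
  (gZ : forall (k : K) x, g (k *: x) = k%:A *: g x)
  (UP : forall Z, points_of U Z <-> exists x, [/\ x \in {:F}%VS, x != 0 & Z = <[g x]>%VS])
  (par : forall x y, x != 0 -> y != 0 -> <[g x]>%VS = <[g y]>%VS -> x * lp y = y * lp x).

(* If x and y are K-independent and proportional in the linear set, then
   w = x^tau y - x y^tau satisfies w^(tau^-1) = delta w, which determines w up
   to K; dividing by x^(tau + 1) shows that x^-1 lies on the quadric
   Tr (w X^(tau + 1)) = 0. *)
Lemma lp_scattered x y : x != 0 -> y != 0 -> <[g x]>%VS = <[g y]>%VS ->
  exists k : K, x = k *: y.
Proof.
move=> nz_x nz_y xy; have [w0|nz_w] := eqVneq (wr x y) 0; first exact: wr_eq0 w0.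
pose w := wr x y; rewrite -/w in nz_w.
have wP : fr (n - s) w = delta * w by apply: wr_parallel (par nz_x nz_y xy).
pose Q z := ftr (w * (fr s z * z)).
(* One quadric serves all pairs: [w / wr a b] is fixed by tau, hence lies in K, and dividing
   [wr a b] by a^(tau + 1) gives b / a - (b / a)^tau, which has trace 0. *)
have onQ a b : a != 0 -> b != 0 -> <[g a]>%VS = <[g b]>%VS ->
    (forall k : K, b != k *: a) -> Q a^-1 = 0.
  move=> nz_a nz_b ab ind.
  have nz_ab : wr a b != 0.
    apply/eqP=> wr0; have [|k kE] := @wr_eq0 b a nz_a.
      by rewrite /wr -opprB [X in - X]wr0 oppr0.
    by case/eqP: (ind k).
  have abP := wr_parallel (par nz_a nz_b ab).
  have [|k kE] := @fr_gen_fixed _ _ _ co_sn (w / wr a b).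
    have nz_d : delta != 0.
      by apply: contraNneq nz_w => d0; move/eqP: wP; rewrite d0 mul0r fmorph_eq0.
    have E : fr (n - s) (w / wr a b) = w / wr a b.
      by rewrite rmorphM fmorphV /= wP abP invfM mulrACA mulfV // mul1r.
    by rewrite -{1}E fr_sn.
  have wE : w = k *: wr a b by rewrite -mulr_algl -kE divfK.
  have nz_sa : fr s a != 0 by rewrite fmorph_eq0.
  have -> : Q a^-1 = k *: (ftr (b / a) - ftr (fr s (b / a))).
    rewrite -ftrN -ftrD -ftrZ /Q wE; congr ftr.
    rewrite -scalerAl; congr (_ *: _); rewrite /wr !rmorphM !fmorphV /=; field; rewrite nz_a nz_sa //.
  by rewrite ftr_fr subrr scaler0.
(* The inverse of an element off the quadric is parallel only to its own K-multiples. There are at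
   least q ^ n - 2 q ^ (n - 1) such elements, enough for [scattered_of_large] because q is at least
   3. *)
pose I : {set fF} := [set z : fF | Q z != 0].
have nzI z : z \in I -> z != 0.
  by rewrite inE; apply: contraNneq => ->; rewrite /Q mulr0 mulr0 ftr0.
have cI : (q ^ n.-1 <= #|I|)%N.
  have := card_quadric (quadric_nz nz_w); have := cardsC I.
  have -> : ~: I = [set z : fF | ftr (w * (fr s (z : F) * z)) == 0].
    by apply/setP=> z; rewrite !inE negbK.
  have -> : #|{: fF}| = (q * q ^ n.-1)%N by rewrite card_ext -expnS (prednK (n_gt0 F)).
  have : (3 * q ^ n.-1 <= q * q ^ n.-1)%N by rewrite leq_mul2r hq orbT.
  have aux (a b c d : nat) : (3 * b <= a -> c + d = a -> d <= 2 * b -> b <= c)%N by lia.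
  exact: aux.
apply: (scattered_of_large (S := fullv) (g := g) scU (erefl _) gZ (erefl _) UP
   (A := I) (x := fun z : fF => (z : F)^-1)) => //; try exact: memvf.
- by move=> z /nzI nz_z; rewrite memvf invr_eq0.
- move=> z Iz; have nz_z := nzI z Iz.
  rewrite -(card_multiples (T := F) nz_z); apply/subset_leq_card/subsetP=> z'.
  rewrite inE => /andP[Iz' /eqP zz']; have nz_z' := nzI z' Iz'.
  apply/imsetP; case: (pickP (fun k : K => (z : F)^-1 == k *: (z' : F)^-1)) => [k /eqP kE|none].
    have nz_k : k != 0 by apply: contraNneq nz_z => k0; rewrite -invr_eq0 kE k0 scale0r.
    exists k; first by rewrite !inE.
    by rewrite -[z in RHS]invrK kE invrZ ?unitfE ?invr_eq0 // scalerA mulfV // scale1r invrK.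
  have := onQ (z' : F)^-1 (z : F)^-1; rewrite !invr_eq0 invrK => /(_ nz_z' nz_z zz').
  by move: Iz'; rewrite inE => /eqP nz Q0; case: nz; apply: Q0 => k; rewrite none.
Qed.

End LPScattered.

(** * Points of large weight *)

Section InvariantSubspaces.

Variables (K : finFieldType) (F : fieldExtType K) (V : vectType F).
Local Notation n := (\dim {:F}).
Variables (m : nat) (e : m.-tuple V).
Hypothesis eB : basis_of fullv e.
Variable S : {vspace restr V}.
Hypothesis SP : forall u : V, (u : restr V) \in S <-> sg e 1 u = u.

(* The traces of the multiples a *: v of a vector v of M lie in M :&: S, and v
   can be recovered from them by independence of the Frobenius powers. *)
Lemma invariant_dim (M : {vspace V}) : (forall u, u \in M -> sg e 1 u \in M) ->
  (\dim M <= \dim (S :&: restr_vspace M))%N.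
Proof.
move=> Minv; set X := (S :&: restr_vspace M)%VS.
pose bX : seq V := vbasis X; pose N := <<bX>>%VS.
have XN (u : V) : (u : restr V) \in X -> u \in N.
  move=> Xu; rewrite (@coord_vbasis K (restr V) u X Xu).
  apply: (@memv_suml F V) => i _.
  by rewrite restr_scaleE memvZ // memv_span // mem_nth // size_tuple.
suff /dimvS le_MN : (M <= N)%VS.
  by apply: leq_trans le_MN _; apply: leq_trans (dim_span _) _; rewrite size_tuple.
have Minvj j u : u \in M -> sg e j u \in M.
  move=> Mu; elim: j => [|j IHj]; first by rewrite sg_id.
  by rewrite -add1n -(sg_comp eB) Minv.
apply/subvP=> v Mv; pose p u := u - projv N u.
have pN u : u \in N -> p u = 0 by move=> Nu; rewrite /p projv_id ?subrr.
suff p0 : p v = 0 by move/eqP: p0; rewrite subr_eq0 => /eqP->; exact: memv_proj.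
apply: (coord_inj eB) => k; rewrite linear0.
(* [l] is an F-linear form vanishing on N, hence on the traces; evaluated at the trace of [a *: v]
   it is a q-polynomial in [a] with coefficients [l (sg e i v)], the one at 0 being [l v]. *)
pose l u := coord e k (p u).
have lD : {morph l : u w / u + w}.
  by move=> u w; rewrite /l /p !(linearD, linearN) /=; ring.
have lZ a u : l (a *: u) = a * l u by rewrite /l /p linearZ /= -scalerBr linearZ.
have l0 : l 0 = 0 by apply: (addrI (l 0)); rewrite -lD !addr0.
suff: l (sg e 0 v) = 0 by rewrite sg_id.
apply: (@fr_independent K F (fun i => l (sg e i v)) _ 0%N (n_gt0 F)) => a.
pose t := \sum_(i < n) sg e i (a *: v).
have tS : (t : restr V) \in S.
  apply/SP; rewrite /t (sg_sum eB).
  rewrite -(big_mkord predT (fun i => sg e 1 (sg e i (a *: v)))).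
  rewrite -(big_mkord predT (fun i => sg e i (a *: v))) -(prednK (n_gt0 F)).
  rewrite big_nat_recr // [RHS]big_nat_recl //= addrC; congr (_ + _).
    by rewrite (sg_comp eB) add1n (prednK (n_gt0 F)) (@sg_eqmod _ _ _ _ _ eB _ 0) // modnn mod0n.
  by apply: eq_bigr => i _; rewrite (sg_comp eB) add1n.
have tM : t \in M by apply: memv_suml => i _; rewrite Minvj // memvZ.
have: l t = 0.
  rewrite /l pN ?linear0 //; apply: XN.
  by rewrite /X memv_cap tS mem_restr_vspace.
rewrite /t (big_morph l lD l0) => lt0; rewrite -[RHS]lt0; apply: eq_bigr => i _.
by rewrite (sgZ eB) lZ mulrC.
Qed.

End InvariantSubspaces.

Section ConeCount.

Variables (K : finFieldType) (F : fieldExtType K) (V W : vectType F).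
Local Notation q := #|K|.
Local Notation fV := (finvect_type (restr V)).
Variables (U : {vspace restr W}) (S : {vspace restr V}) (h : 'Hom(V, W)) (n : nat).
Hypotheses (hq : (2 < q)%N) (hn : (4 <= n)%N) (scU : scattered U) (dimS : \dim S = n)
  (h_neq0 : forall u : V, (u : restr V) \in S -> u != 0 -> h u != 0)
  (UP : forall Z, points_of U Z <->
          exists x : restr V, [/\ x \in S, x != 0 & Z = <[h x]>%VS]).
Variable m0 : V.
Hypotheses (Sm0 : (m0 : restr V) \in S) (nz_m0 : m0 != 0).

(** [d], the dimension of this space, is the weight of the point of [h m0] with respect to the image
    of S. *)
Let S0 := (S :&: restr_vspace (h @^-1: <[h m0]>))%VS.
Let d := \dim S0.

Let S0P (u : V) : reflect ((u : restr V) \in S /\ h u \in <[h m0]>%VS) ((u : restr V) \in S0).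
Proof. by rewrite memv_cap mem_restr_vspace -memv_preim; apply: andP. Qed.

Let hZ (k : K) (x : restr V) : h (k *: x) = k%:A *: h x.
Proof. by rewrite restr_scaleE linearZ. Qed.

Let hD (x y : V) : h (x + y) = h x + h y.
Proof. exact: linearD. Qed.

Let q1 := q_gt1 K.

(* If h maps an (n-2)-dimensional subspace of S into one point, then the linear
   set of h @: S is a union of cones over this point, and its number of points
   is not of the form (q^rho - 1) / (q - 1). *)
Lemma no_heavy_point : (n - 2 <= d)%N ->
  (exists u : V, (u : restr V) \in S /\ h u \notin <[h m0]>%VS) -> False.
Proof.
move=> le_d [s1 [Ss1 hs1]].
have m0S0 : (m0 : restr V) \in S0 by apply/S0P; rewrite memv_line.
have lt_rho : (\dim U < n)%N.
  have [x S0x m0x] : exists2 x : restr V, x \in S0 & x \notin <[m0 : restr V]>%VS.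
    apply/subvPn; apply: contraTN (le_d) => /dimvS; rewrite -/d dim_vline nz_m0; lia.
  have nz_x : x != 0 by apply: contraNneq m0x => ->; rewrite mem0v.
  have [Sx /vlineP[c hx]] := S0P x S0x.
  have nz_c : c != 0.
    by apply: contraTneq (h_neq0 Sx nz_x) => c0; rewrite hx c0 scale0r negbK.
  apply: (@nonscattered_rank _ _ _ U _ scU erefl (restr V) S h n hZ dimS UP x m0) => //.
    apply/eqP; rewrite hx eqEsubv -!memvE memvZ ?memv_line //=.
    by apply/vlineP; exists c^-1; rewrite scalerA mulVf ?scale1r.
  by move=> k; apply: contraNneq m0x => ->; rewrite memvZ // memv_line.
pose B0 : {set fV} := [set w : fV | (w : restr V) \in S0].
have cB0 : #|B0| = (q ^ d)%N by rewrite card_vspace_set.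
have hS0 (w : V) : (w : restr V) \in S0 -> exists a, h w = a *: h m0.
  by case/S0P=> _ /vlineP.
have SS0 (s w : V) : (s : restr V) \in S -> (w : restr V) \in S0 -> (s + w : restr V) \in S.
  by move=> Ss /S0P[Sw _]; apply: (@memvD K (restr V)).
have free (s : V) (a b : F) : h s \notin <[h m0]>%VS -> a *: h s = b *: h m0 -> a = 0.
  move=> hs E; apply: contraNeq hs => nz_a; apply/vlineP; exists (a^-1 * b).
  by rewrite -scalerA -E scalerA mulVf ?scale1r.
have par_eq (x y : W) : <[x]>%VS = <[y]>%VS -> exists c, x = c *: y.
  by move=> E; apply/vlineP; rewrite -E memv_line.
(* A coset s + S0 other than S0 maps injectively to points: comparing two images modulo [h m0] shows
   that their ratio is 1, and [h] is injective on S. *)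
have inj (s w w' : V) : (s : restr V) \in S -> h s \notin <[h m0]>%VS ->
    (w : restr V) \in S0 -> (w' : restr V) \in S0 ->
    <[h (s + w)%R]>%VS = <[h (s + w')%R]>%VS -> w = w'.
  move=> Ss hs S0w S0w' /par_eq[c]; have [[a aE] [b bE]] := (hS0 w S0w, hS0 w' S0w').
  rewrite !hD scalerDr aE bE => E.
  have c1 : 1 - c = 0.
    apply: (free s _ (c * b - a)) => //; rewrite !scalerBl scale1r -scalerA.
    by apply/eqP; rewrite subr_eq addrAC eq_sym subr_eq E addrC.
  have{c1} c1 : c = 1 by apply/esym/eqP; rewrite -subr_eq0 c1.
  rewrite c1 !scale1r -aE -bE in E; have /addrI/eqP := E.
  rewrite -subr_eq0 -linearB /= => /eqP h0; apply/eqP; rewrite -subr_eq0; apply: contraT => nz.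
  have Sww : (w - w' : restr V) \in S.
    by case/S0P: S0w => Sw _; case/S0P: S0w' => Sw' _; apply: (@memvB K (restr V)).
  by have := h_neq0 Sww nz; rewrite h0 eqxx.
have nz (s w : V) : h s \notin <[h m0]>%VS -> (w : restr V) \in S0 -> s + w != 0.
  move=> hs S0w; apply: contraNneq hs => /eqP; rewrite addr_eq0 => /eqP->.
  by rewrite linearN /= memvN; case/S0P: S0w.
have bound1 : ((q - 1) * q ^ d <= 1 * (q ^ \dim U - 1))%N.
  rewrite -cB0; apply: (scattered_count_ge (g := fun w : fV => h (s1 + w)) scU erefl).
    move=> w; rewrite inE => S0w; apply/UP; exists (s1 + w); split=> //; first exact: SS0.
    exact: nz.
  move=> w; rewrite inE => S0w; rewrite -(cards1 w); apply/subset_leq_card/subsetP=> w'.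
  by rewrite !inE => /andP[S0w' /eqP/inj E]; rewrite E.
have pd : (0 < q ^ d)%N by rewrite expn_gt0; lia.
have lt_d : (d < \dim U)%N.
  rewrite -(ltn_exp2l _ _ q1).
  apply: leq_ltn_trans (_ : (q - 1) * q ^ d < _)%N; first by rewrite leq_pmull //; lia.
  by apply: leq_ltn_trans bound1 _; rewrite mul1n subn1 prednK // expn_gt0; lia.
(* The rank exceeds d, since a single coset already gives q ^ d points, and it is less than n, which
   is at most d + 2. *)
have dimU : \dim U = d.+1 by lia.
have d_gt1 : (1 < d)%N by lia.
(* If the point of [h m0] and those of s1 + S0 were all the points, then q ^ d + 1 would be at least
   (q ^ d.+1 - 1) / (q - 1), so q ^ d would be at most q, contrary to d > 1. Hence some [s2] maps to
   a further point. *)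
have [/existsP[s2]|/existsPn cov] := boolP [exists s2 : fV,
    [&& (s2 : restr V) \in S, h s2 \notin <[h m0]>%VS &
        [forall w : fV, ((w : restr V) \in S0) ==> (<[h s2]>%VS != <[h (s1 + w)%R]>%VS)]]]; last first.
  pose A : {set option fV} := None |: [set Some w | w in B0].
  have cA : #|A| = (q ^ d).+1.
    rewrite cardsU1 card_imset ?cB0; last by move=> ? ? [].
    by case: imsetP => // -[].
  have := @scattered_count_le _ _ _ U _ scU erefl _ A
    (fun o => if o is Some w then h (s1 + (w : V)) else h m0) 1.
  rewrite cA dimU => /(_ _)/[!mul1n] bnd.
  have {bnd} : (q ^ d.+1 - 1 <= (q - 1) * (q ^ d).+1)%N.
    apply: bnd => Z /UP[x [Sx nz_x ->]]; apply/card_gt0P.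
    have [S0x|nS0x] := boolP (x \in S0).
      exists None; rewrite !inE /= eq_sym line_eq ?h_neq0 //.
      by case/S0P: S0x.
    have hx : h x \notin <[h m0]>%VS by apply: contra nS0x => hx; apply/S0P.
    have := cov x; rewrite Sx hx /= negb_forall => /existsP[w].
    rewrite negb_imply negbK => /andP[S0w /eqP E].
    by exists (Some w); rewrite !inE mem_imset ?inE ?S0w ?E ?eqxx //; move=> ? ? [].
  have : (q * q <= q ^ d)%N by rewrite -(expnS q 1%N) -[X in (X <= _)%N]/(q ^ 2)%N leq_exp2l.
  have : (2 * q < q * q)%N by rewrite ltn_mul2r; lia.
  rewrite expnS mulnS; move: (q ^ d)%N (q * q)%N pd => X Y; rewrite mulnBl mul1n.
  have : (X <= q * X)%N by rewrite leq_pmull; lia.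
  move: (q * X)%N; lia.
case/and3P=> Ss2 hs2 /forallP far.
pose Bad : {set fV} := [set w in B0 | [exists w' : fV,
  ((w' : restr V) \in S0) && (<[h (s2 + (w : V))%R]>%VS == <[h (s1 + (w' : V))%R]>%VS)]].
have BadP (w : V) : (w : fV) \in Bad -> (w : restr V) \in S0 /\
    exists2 w' : V, (w' : restr V) \in S0 & <[h (s2 + (w : V))%R]>%VS = <[h (s1 + (w' : V))%R]>%VS.
  by rewrite !inE => /andP[S0w /existsP[w' /andP[S0w' /eqP E]]]; split=> //; exists w'.
have nBad0 : (0 : fV) \notin Bad.
  apply/negP=> /BadP[_ [w' S0w']]; rewrite addr0 => E.
  by have := far w'; rewrite S0w' E eqxx.
(* Bad is an affine subspace of S0 not containing 0, so its nonzero multiples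
   are disjoint *)
have cBad : ((q - 1) * #|Bad| <= q ^ d - 1)%N.
  rewrite -card_vspace_nz subn1 -(cardsC1 (0 : K)) -cardsX.
  pose mult (kw : K * fV) : fV := kw.1 *: (kw.2 : restr V).
  rewrite -(@card_in_imset _ _ mult).
    apply/subset_leq_card/subsetP=> x /imsetP[[k w] + ->].
    rewrite in_setX /= in_setC1 => /andP[nz_k Bw].
    have [S0w _] := BadP w Bw; rewrite inE /mult /= memvZ // scaler_eq0 negb_or nz_k /=.
    by apply: contraNneq nBad0 => <-.
  move=> [k w] [k' w']; rewrite !in_setX /= !in_setC1 => /andP[nz_k Bw] /andP[nz_k' Bw'].
  rewrite /mult /= => E.
  have wE : (w : restr V) = (k^-1 * k') *: (w' : restr V).
    by rewrite -scalerA -E scalerA mulVf ?scale1r.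
  set l := k^-1 * k' in wE.
  have [l1|nl1] := eqVneq l 1.
    have ww' : w = w' by rewrite wE l1 scale1r.
    by rewrite ww'; congr (_, _); rewrite -[RHS]mul1r -(mulfV nz_k) -mulrA -/l l1 mulr1.
  have [S0w [v S0v Ev]] := BadP w Bw; have [S0w' [v' S0v' Ev']] := BadP w' Bw'.
  have [c cE] := par_eq _ _ Ev.
  have [c' c'E] := par_eq _ _ Ev'.
  have hw : h w = l%:A *: h w' by rewrite [in LHS]wE restr_scaleE linearZ.
  (* Modulo [h m0], both factors equal the ratio of [h s2] to [h s1]. *)
  have cc' : c = c'.
    have [[a aE] [[b bE] [b' b'E]]] := (hS0 w' S0w', (hS0 v S0v, hS0 v' S0v')).
    apply/eqP; rewrite -subr_eq0; apply/eqP.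
    apply: (free s1 _ (l%:A * a - a - c * b + c' * b')) => //.
    rewrite !hD hw aE bE b'E in cE c'E.
    have := congr2 (fun x y => x - y) cE c'E; rewrite /= !scalerDr !scalerA.
    rewrite opprD addrACA subrr add0r opprD addrACA -!scalerBl => E2.
    rewrite -[LHS](addrK ((c * b - c' * b') *: h m0)) -E2 -scalerBl; congr (_ *: _); ring.
  (* If [w'] and [w], equal to l times [w'], are both bad and l is not 1, then 0 is the affine
     combination (l w' - w) / (l - 1) of them. The same combination of the partners gives a vector
     [v''] whose coset point is that of [s2], contrary to the choice of [s2]. *)
  pose r : K := (l - 1)^-1; have nz_l1 : l - 1 != 0 by rewrite subr_eq0.
  pose v'' : V := r *: ((l *: (v' : restr V) - v) : restr V).
  have S0v'' : (v'' : restr V) \in S0 by rewrite memvZ // memvB // memvZ.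
  have := far v''; rewrite S0v'' /= => /eqP; case; apply/eqP; rewrite line_eq; last first.
    by apply: contraNneq hs2 => ->; rewrite mem0v.
  apply/vlineP; exists c.
  have E1 : (l - 1)%:A *: h s2 = c *: ((l - 1)%:A *: h s1 + h ((l *: (v' : restr V) - v) : restr V)).
    have -> : h ((l *: (v' : restr V) - v) : restr V) = l%:A *: h v' - h v.
      by rewrite -[LHS]/(h ((l%:A *: (v' : V)) - v)) linearB linearZ.
    rewrite -cc' in c'E; rewrite !hD hw in cE c'E.
    rewrite !scalerBl !scale1r.
    have := congr2 (fun x y => l%:A *: y - x) cE c'E => /=.
    rewrite !scalerDr opprD addrACA subrr addr0 => ->.
    by rewrite !scalerN !scalerA ![l%:A * c]mulrC opprD addrACA.
  have rl : r%:A * (l - 1)%:A = 1 :> F by rewrite -!in_algE -rmorphM /= mulVf ?scale1r.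
  have := congr1 (fun x => r%:A *: x) E1; rewrite /= scalerA rl scale1r => ->.
  rewrite scalerA mulrC -scalerA scalerDr scalerA rl scale1r hD; congr (_ *: (_ + _)).
  by rewrite /v'' restr_scaleE linearZ.
(* The cosets of [s1] and [s2], without the bad part of the second, give 2 q ^ d - #|Bad| distinct
   points. With the bound on [Bad], this exceeds (q ^ d.+1 - 1) / (q - 1) as soon as q is at least
   3. *)
pose A : {set bool * fV} := [set i | if i.1 then i.2 \in B0 else i.2 \in B0 :\: Bad].
have cA : (#|A| + #|Bad| = 2 * q ^ d)%N.
  have -> : A = setX [set true] B0 :|: setX [set false] (B0 :\: Bad).
    by apply/setP=> -[[] w]; rewrite !inE /= ?andbF ?orbF ?andbT ?orFb.
  rewrite cardsU; have -> : setX [set true] B0 :&: setX [set false] (B0 :\: Bad) = set0.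
    by apply/setP=> -[[] w]; rewrite !inE /= ?andbF.
  rewrite !cardsX !cards1 !mul1n cards0 subn0 cardsD (setIidPr _); last first.
    by apply/subsetP=> w /BadP[S0w _]; rewrite inE.
  rewrite -addnA subnK ?cB0 ?mul2n ?addnn // -cB0 subset_leq_card //.
  by apply/subsetP=> w /BadP[S0w _]; rewrite inE.
pose g (i : bool * fV) : W := h ((if i.1 then s1 else s2) + (i.2 : V)).
have := @scattered_count_ge _ _ _ U _ scU erefl _ A g 1.
rewrite dimU => bnd; have {bnd} : ((q - 1) * #|A| <= 1 * (q ^ d.+1 - 1))%N.
  apply: bnd => [] [b w] Ai.
    have S0w : (w : restr V) \in S0 by move: Ai; rewrite !inE; case: b => //= /andP[].
    apply/UP; exists ((if b then s1 else s2) + w); split=> //.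
      by case: b {Ai}; apply: SS0.
    by case: b {Ai}; apply: nz.
  rewrite -(cards1 (b, w)); apply/subset_leq_card/subsetP=> -[b' w'].
  rewrite inE => /andP[Ai' /eqP]; rewrite /g /=; move: Ai Ai'; rewrite !inE /=.
  case: b; case: b' => //=.
  - by move=> S0w S0w' /inj->.
  - move=> S0w /andP[nB S0w'] E; case/negP: nB; rewrite S0w' /=.
    by apply/existsP; exists w; rewrite S0w E eqxx.
  - move=> /andP[nB S0w] S0w' E; case/negP: nB; rewrite S0w /=.
    by apply/existsP; exists w'; rewrite S0w' E eqxx.
  - by move=> /andP[_ S0w] /andP[_ S0w'] /inj->.
have : (3 * q ^ d <= q * q ^ d)%N by rewrite leq_mul2r hq orbT.
have := congr1 (muln (q - 1)) cA; rewrite mulnDr expnS mulnCA.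
move: cBad; rewrite [((q - 1) * q ^ d)%N]mulnBl !mul1n.
have aux (a b x y : nat) : (0 < x -> a <= x - 1 -> b + a = 2 * (y - x) -> 3 * x <= y ->
  b <= y - 1 -> False)%N by lia.
exact: aux.
Qed.

End ConeCount.

(** * The orbit of the vertex point *)

Lemma dim_add_line (F : fieldType) (V : vectType F) (X : {vspace V}) (v : V) :
  \dim (X + <[v]>) = (\dim X + (v \notin X))%N.
Proof.
have [Xv|nXv] /= := boolP (v \in X).
  by rewrite (addv_idPl _) ?addn0 // -memvE.
rewrite dimv_disjoint_sum; last first.
  apply/eqP; rewrite -subv0; apply/subvP=> u /memv_capP[Xu /vlineP[a uE]].
  rewrite memv0 uE; move: Xu; rewrite uE; have [->|nz_a] := eqVneq a 0; first by rewrite scale0r.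
  move=> Xav; case/negP: nXv; rewrite -[v](scalerK nz_a); exact: memvZ.
by rewrite dim_vline; have -> : v != 0 by apply: contraNneq nXv => ->; rewrite mem0v.
Qed.

Section Frame.

Variables (K : finFieldType) (F : fieldExtType K) (V : vectType F) (n : nat).
Hypotheses (hn : (4 <= n)%N) (hF : \dim {:F} = n) (hV : \dim {:V} = n).
Variables (m : nat) (e : m.-tuple V).
Hypothesis eB : basis_of fullv e.
Variable S : {vspace restr V}.
Hypothesis SP : forall u : V, (u : restr V) \in S <-> sg e 1 u = u.
Variable s : nat.
Hypothesis co_sn : coprime s n.
Variable p : V.

Definition orb i := sg e (s * i) p.
Definition msp k := (\sum_(i < k) <[orb i]>)%VS.

Let sgsl := sg_semilinear1 eB s.

Lemma sg_orb i : sg e s (orb i) = orb i.+1.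
Proof. by rewrite /orb (sg_comp eB) mulnS. Qed.

Lemma orb_mod i j : i = j %[mod n] -> orb i = orb j.
Proof.
by move=> ij; apply: (sg_eqmod eB); rewrite hF -modnMmr ij modnMmr.
Qed.

Lemma orb_n : orb n = orb 0.
Proof. by apply: orb_mod; rewrite modnn mod0n. Qed.

Lemma sg_invariant1 (M : {vspace V}) :
  (forall u, u \in M -> sg e s u \in M) -> forall u, u \in M -> sg e 1 u \in M.
Proof.
move=> Minv u Mu; have [|t st1] := @coprime_invmod _ F s; first by rewrite hF.
rewrite -(sg_eqmod eB u st1); elim: t {st1} => [|t IHt]; first by rewrite muln0 sg_id.
by rewrite mulnS -(sg_comp eB) Minv.
Qed.

Lemma mspS k : msp k.+1 = (msp k + <[orb k]>)%VS.
Proof. by rewrite /msp big_ord_recr. Qed.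

Lemma dim_mspS k : \dim (msp k.+1) = (\dim (msp k) + (orb k \notin msp k))%N.
Proof. by rewrite mspS dim_add_line. Qed.

Lemma dim_msp_le k : (\dim (msp k) <= k)%N.
Proof.
elim: k => [|k IHk]; first by rewrite /msp big_ord0 dimv0.
by rewrite dim_mspS -addn1 leq_add // leq_b1.
Qed.

Lemma orb_msp i k : (i < k)%N -> orb i \in msp k.
Proof.
by move=> lt_ik; rewrite memvE; apply: (sumv_sup (Ordinal lt_ik)).
Qed.

Lemma msp_subP k (X : {vspace V}) :
  (forall i, (i < k)%N -> orb i \in X) -> (msp k <= X)%VS.
Proof. by move=> Xi; apply/subv_sumP=> i _; rewrite -memvE Xi. Qed.

Lemma mspW j k : (j <= k)%N -> (msp j <= msp k)%VS.
Proof. by move=> le_jk; apply: msp_subP => i lt_ij; apply: orb_msp; apply: leq_trans le_jk. Qed.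

Lemma imgv_msp k : imgv (sg e s) (msp k) = (\sum_(i < k) <[orb i.+1]>)%VS.
Proof.
rewrite /msp (imgv_sum _ _ sgsl); apply: eq_bigr => i _.
by rewrite (imgv_line _ sgsl) sg_orb.
Qed.

Lemma imgv_msp_sub k : (imgv (sg e s) (msp k) <= msp k.+1)%VS.
Proof. by rewrite imgv_msp; apply/subv_sumP=> i _; rewrite -memvE orb_msp // ltnS. Qed.

Lemma msp_invariant k : orb k \in msp k -> forall u, u \in msp k -> sg e s u \in msp k.
Proof.
move=> kk u ku; have -> : msp k = msp k.+1 by rewrite mspS; apply/esym/addv_idPl; rewrite -memvE.
by apply: (subvP (imgv_msp_sub k)); rewrite mem_imgv.
Qed.

Variables (G Q : {vspace V}).
Hypotheses (dimG : \dim G = (n - 2)%N)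
  (GS : forall u : V, (u : restr V) \in S -> u != 0 -> u \notin G)
  (GE : G = (msp (n - 3) + Q)%VS) (dimQ : \dim Q = 1%N)
  (capG : forall X : {vspace V}, (X <= G)%VS -> (X <= imgv (sg e s) G)%VS -> (\dim X <= n - 4)%N)
  (heavy : forall M : {vspace V}, (forall u, u \in M -> sg e 1 u \in M) ->
     \dim M = (n - 2)%N -> (n - 3 <= \dim (M :&: G))%N -> False).

Lemma msp_subG : (msp (n - 3) <= G)%VS.
Proof. by rewrite GE addvSl. Qed.

Lemma dim_msp3 : \dim (msp (n - 3)) = (n - 3)%N.
Proof.
apply/eqP; rewrite eqn_leq dim_msp_le /=.
have := dimv_leqif_eq (subvv G); have [+ _] := dimv_add_leqif (msp (n - 3)) Q.
by rewrite -GE dimG dimQ; lia.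
Qed.

(** Otherwise this nonzero subspace of G is invariant, so by [invariant_dim] it contains a point of
    the subgeometry. *)
Lemma orb3_notin : orb (n - 3) \notin msp (n - 3).
Proof.
apply/negP=> /msp_invariant/sg_invariant1 inv1.
have := invariant_dim eB SP inv1; rewrite dim_msp3 => le_dim.
have : (S :&: restr_vspace (msp (n - 3)) != 0)%VS.
  by rewrite -dimv_eq0 -lt0n; apply: leq_trans le_dim; lia.
rewrite -vpick0; set v := vpick _ => nz_v.
have := memv_pick (S :&: restr_vspace (msp (n - 3)))%VS.
rewrite memv_cap mem_restr_vspace => /andP[Sv Mv].
by have := GS Sv nz_v; rewrite (subvP msp_subG).
Qed.

Lemma dim_msp2 : \dim (msp (n - 2)) = (n - 2)%N.
Proof.
have -> : (n - 2 = (n - 3).+1)%N by lia.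
by rewrite dim_mspS orb3_notin dim_msp3 addn1.
Qed.

(** Otherwise the span is invariant of dimension n - 2 and meets G in codimension at most 1, so it
    projects to a single point of too large weight. *)
Lemma orb2_notin : orb (n - 2) \notin msp (n - 2).
Proof.
apply/negP=> /msp_invariant/sg_invariant1 inv1.
apply: (heavy inv1 dim_msp2); rewrite -dim_msp3; apply: dimvS.
by rewrite subv_cap msp_subG andbT; apply: mspW; lia.
Qed.

Lemma dim_msp1 : \dim (msp (n - 1)) = (n - 1)%N.
Proof.
have -> : (n - 1 = (n - 2).+1)%N by lia.
by rewrite dim_mspS orb2_notin dim_msp2 addn1.
Qed.

Hypothesis meetG : ((<[orb (n - 1)]> + <[orb (n - 3)]>) :&: G != 0)%VS.

Lemma meetGP : exists a b, a *: orb (n - 1) + b *: orb (n - 3) \in G /\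
  a *: orb (n - 1) + b *: orb (n - 3) != 0.
Proof.
move: meetG; rewrite -vpick0; set v := vpick _ => nz_v.
have := memv_pick ((<[orb (n - 1)]> + <[orb (n - 3)]>) :&: G)%VS.
rewrite -/v => /memv_capP[/memv_addP[_ /vlineP[a ->] [_ /vlineP[b ->] vE]] Gv].
by exists a, b; rewrite -vE.
Qed.

(** Otherwise M = [msp (n - 1)] is an invariant hyperplane. If it contained G, then G and its image,
    both inside M, would meet in dimension at least n - 3, against [capG]. So G meets M exactly in
    [msp (n - 3)], which then contains the vector of (iv). This puts [orb (n - 1)] into
    [msp (n - 2)], so that all of M lies in the image of [msp (n - 2)], of smaller dimension. *)
Lemma orb1_notin : orb (n - 1) \notin msp (n - 1).
Proof.
apply/negP=> in1; have inv := msp_invariant in1; set M := msp (n - 1) in inv.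
have dimM : \dim M = (n - 1)%N := dim_msp1.
have nGM : ~~ (G <= M)%VS.
  apply/negP=> GM.
  have GM' : (imgv (sg e s) G <= M)%VS.
    by apply/subvP=> _ /(imgvP _ _ sgsl)[u Gu ->]; apply: inv; apply: (subvP GM).
  have := capG (capvSl G (imgv (sg e s) G)) (capvSr _ _).
  have := dimv_sum_cap G (imgv (sg e s) G); rewrite (dim_imgv _ sgsl) dimG.
  have : (G + imgv (sg e s) G <= M)%VS by rewrite subv_add GM.
  move/dimvS; rewrite dimM; lia.
have GME : (G :&: M)%VS = msp (n - 3).
  apply/esym/eqP; rewrite eqEdim subv_cap msp_subG mspW /=; last by lia.
  rewrite dim_msp3 -ltnS; have -> : ((n - 3).+1 = \dim G)%N by rewrite dimG; lia.
  rewrite (ltn_leqif (dimv_leqif_sup (capvSl _ _))); apply: contra nGM => h.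
  exact: subv_trans h (capvSr _ _).
have [a [b []]] := meetGP; set z := (_ + _ : V) => Gz nz_z.
have : z \in (G :&: M)%VS.
  rewrite memv_cap Gz memvD ?memvZ //; apply: orb_msp; lia.
rewrite GME => Mz; have [a0|nz_a] := eqVneq a 0.
  have nz_b : b != 0 by apply: contraNneq nz_z => b0; rewrite /z a0 b0 !scale0r addr0.
  have := orb3_notin; rewrite -[orb _](scalerK nz_b) memvZ //.
  by move: Mz; rewrite /z a0 scale0r add0r.
have in2 : orb (n - 1) \in msp (n - 2).
  rewrite -[orb (n - 1)](scalerK nz_a) memvZ // -[_ *: _](addrK (b *: orb (n - 3))) -/z.
  rewrite memvB ?memvZ ?orb_msp //; last by lia.
  by apply: (subvP (mspW _)) Mz; lia.
have /dimvS : (msp (n - 1) <= imgv (sg e s) (msp (n - 2)))%VS.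
  apply: msp_subP => -[_|i lt_i].
    have -> : orb 0 = sg e s (orb (n - 1)).
      by rewrite sg_orb -orb_n; congr orb; lia.
    by rewrite mem_imgv.
  by rewrite -sg_orb mem_imgv // orb_msp //; lia.
rewrite dim_msp1 (dim_imgv _ sgsl) dim_msp2; lia.
Qed.

Lemma msp_full : msp n = fullv.
Proof.
apply/eqP; rewrite eqEdim subvf hV; have -> : (n = (n - 1).+1)%N by lia.
by rewrite dim_mspS orb1_notin dim_msp1 addn1 leqnn.
Qed.

(** If one coefficient vanishes, G contains [orb (n - 3)] or [orb (n - 1)], that is, a further
    neighbour of the chain [msp (n - 3)]. Then G and its image share a subspace of dimension n - 3,
    against [capG]. *)
Lemma meetG_coef : exists a b, [/\ a != 0, b != 0 &
  a *: orb (n - 1) + b *: orb (n - 3) \in G].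
Proof.
have [a [b [Gz nz_z]]] := meetGP; exists a, b; split=> //.
  apply/eqP=> a0; rewrite a0 scale0r add0r in Gz nz_z.
  have nz_b : b != 0 by apply: contraNneq nz_z => ->; rewrite scale0r.
  have Go : orb (n - 3) \in G by rewrite -[orb _](scalerK nz_b) memvZ.
  have := capG _ (imgvS sgsl msp_subG); rewrite (dim_imgv _ sgsl) dim_msp3.
  suff sub : (imgv (sg e s) (msp (n - 3)) <= G)%VS by move/(_ sub); lia.
  apply: subv_trans (imgv_msp_sub _) _; rewrite mspS subv_add msp_subG /=.
  by rewrite -memvE.
apply/eqP=> b0; rewrite b0 scale0r addr0 in Gz nz_z.
have nz_a : a != 0 by apply: contraNneq nz_z => ->; rewrite scale0r.
have Go : orb (n - 1) \in G by rewrite -[orb _](scalerK nz_a) memvZ.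
have := capG msp_subG; rewrite dim_msp3.
suff sub : (msp (n - 3) <= imgv (sg e s) G)%VS by move/(_ sub); lia.
apply: msp_subP => -[_|i lt_i].
  have -> : orb 0 = sg e s (orb (n - 1)).
    by rewrite sg_orb -orb_n; congr orb; lia.
  by rewrite mem_imgv.
by rewrite -sg_orb mem_imgv // (subvP msp_subG) // orb_msp //; lia.
Qed.

End Frame.

Lemma imgv_eq_line (F : fieldType) (V W : vectType F) (f : V -> W) (g : W -> V) X w :
  semilinear_bij f -> cancel f g -> cancel g f ->
  imgv f X = <[w]>%VS <-> X = <[g w]>%VS.
Proof.
move=> hf fK gK; have hg := semilinear_inv hf fK; split=> [E|->].
  rewrite -(imgv_line w hg) -E; apply/vspaceP=> u.
  by rewrite -{2}[u]fK !mem_imgv.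
by rewrite (imgv_line _ hf) gK.
Qed.

(** * The K-space underlying an LP-type set *)

Section LPVector.

Variables (K : finFieldType) (F : fieldExtType K).
Local Notation n := (\dim {:F}).

Lemma dim_F2 : \dim {:F2 F} = 2%N.
Proof. by rewrite dimvf. Qed.

Variables (s : nat) (delta : F).

Lemma lpD : {morph lp s delta : x y / x + y}.
Proof. by move=> x y; rewrite /lp !rmorphD /=; ring. Qed.

Lemma lpZ (k : K) x : lp s delta (k *: x) = k *: lp s delta x.
Proof. by rewrite /lp !frZ scalerDr scalerAr. Qed.

Definition lp_vec (x : F) : restr (F2 F) := ((x, lp s delta x) : F2 F).

Fact lp_vec_linear : linear lp_vec.
Proof.
move=> k x y; rewrite restr_scaleE /lp_vec lpD lpZ.
by congr (_, _); rewrite -[X in _ = X + _]/(_ * _) mulr_algl.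
Qed.

HB.instance Definition _ := GRing.isLinear.Build K F (restr (F2 F)) _ lp_vec lp_vec_linear.

Definition lp_space : {vspace restr (F2 F)} := limg (linfun lp_vec).

Lemma mem_lp_space (v : F2 F) :
  reflect (exists x, v = lp_vec x) ((v : restr (F2 F)) \in lp_space).
Proof.
apply: (iffP idP) => [/memv_imgP[x _ ->]|[x ->]]; first by exists x; rewrite lfunE.
by rewrite -[lp_vec x](lfunE lp_vec) memv_img ?memvf.
Qed.

Lemma dim_lp_space : \dim lp_space = n.
Proof.
rewrite limg_dim_eq //; apply/eqP; rewrite -subv0; apply/subvP=> x.
rewrite memv_cap memv_ker lfunE memv0 => /andP[_ /eqP E].
by have /= -> := congr1 (fun v : F2 F => v.1) E.
Qed.

Lemma LP_set_points Z : LP_set n s delta Z <-> points_of lp_space Z.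
Proof.
split=> [[x nz_x ->]|[v [/mem_lp_space[x ->] nz_v ->]]].
  exists (lp_vec x); split=> //; first by apply/mem_lp_space; exists x.
  by apply: contraNneq nz_x => E; have /= -> := congr1 (fun v : F2 F => v.1) E.
exists x => //; apply: contraNneq nz_v => ->.
by apply/eqP; exact: (linear0 lp_vec).
Qed.

Lemma scattered_lp_space :
  (forall x y, x != 0 -> y != 0 -> <[lp_vec x : F2 F]>%VS = <[lp_vec y : F2 F]>%VS ->
     exists k : K, x = k *: y) ->
  maximum_scattered_linear_set (LP_set n s delta).
Proof.
move=> sc; exists lp_space; split; [|exact: dim_lp_space|exact: LP_set_points].
move=> _ [v [/mem_lp_space[x ->] nz_v ->]]; rewrite /weight.
have nz_x : x != 0.
  by apply: contraNneq nz_v => ->; apply/eqP; exact: (linear0 lp_vec).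
suff -> : (lp_space :&: restr_vspace <[lp_vec x : F2 F]> = <[lp_vec x]>)%VS.
  by rewrite dim_vline nz_v.
apply/vspaceP=> w; rewrite memv_cap mem_restr_vspace.
apply/andP/vlineP=> [[/mem_lp_space[y ->] yx]|[k ->]]; last first.
  split; first by rewrite memvZ //; apply/mem_lp_space; exists x.
  by rewrite restr_scaleE memvZ // memv_line.
have [y0|nz_y] := eqVneq y 0; first by exists 0; rewrite scale0r y0 (linear0 lp_vec).
have nz_ly : lp_vec y != 0.
  by apply: contraNneq nz_y => E; have /= -> := congr1 (fun v : F2 F => v.1) E.
have [|k ->] := sc y x nz_y nz_x; first by apply/eqP; rewrite line_eq.
by exists k; rewrite linearZ.
Qed.

End LPVector.

(** * From the conditions on the vertex to LP-type *)

Section Backward.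

Variables (K : finFieldType) (F : fieldExtType K) (V : vectType F) (n : nat).
Local Notation q := #|K|.
Local Notation fV := (finvect_type (restr V)).
Hypotheses (hq : (2 < q)%N) (hn : (4 <= n)%N) (hF : \dim {:F} = n) (hV : \dim {:V} = n).
Variables (m : nat) (e : m.-tuple V).
Hypothesis eB : basis_of fullv e.
Variable S : {vspace restr V}.
Hypotheses (SP : forall u : V, (u : restr V) \in S <-> sg e 1 u = u)
  (dimS : \dim S = n)
  (spanS : forall W : {vspace V}, (forall u : V, (u : restr V) \in S -> u \in W) -> W = fullv).
Variable s : nat.
Hypotheses (co_sn : coprime s n) (lt_sn : (s < n)%N).

Lemma sg_fixed_gen u : sg e s u = u -> (u : restr V) \in S.
Proof.
move=> fu; have [|t st1] := @coprime_invmod _ F s; first by rewrite hF.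
apply/SP; rewrite -(sg_eqmod eB u st1); elim: t {st1} => [|t IHt]; first by rewrite muln0 sg_id.
by rewrite mulnS -(sg_comp eB) IHt.
Qed.

Section Parametrization.

Variable p : V.
Hypothesis orb_full : msp e s p n = fullv.
Local Notation orb := (orb e s p).

Let E : n.-tuple V := [tuple orb i | i < n].

Let EE (i : 'I_n) : E`_i = orb i.
Proof. by rewrite -tnth_nth tnth_mktuple. Qed.

Let E_basis : basis_of fullv E.
Proof.
rewrite basisEdim size_tuple hV leqnn andbT -orb_full; apply: msp_subP => i lt_in.
by rewrite -[i]/(val (Ordinal lt_in)) -EE memv_span // mem_nth ?size_tuple.
Qed.

(** The shift by 2 puts x at [orb (n - 2)], x^tau at [orb (n - 1)] and x^(tau^-1) at [orb (n - 3)],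
    the three orbit vectors that the projection does not kill. *)
Definition cyc (x : F) : V := \sum_(i < n) fr (s * (i + 2)) x *: orb i.

Lemma cyc_S x : (cyc x : restr V) \in S.
Proof.
apply: sg_fixed_gen; rewrite /cyc (sg_sum eB).
have -> : \sum_(i < n) sg e s (fr (s * (i + 2)) x *: orb i) =
    \sum_(i < n) fr (s * (i.+1 + 2)) x *: orb i.+1.
  by apply: eq_bigr => i _; rewrite (sgZ eB) fr_comp (sg_orb eB) -mulnS.
rewrite -(big_mkord predT (fun i => fr (s * (i.+1 + 2)) x *: orb i.+1)).
rewrite -(big_mkord predT (fun i => fr (s * (i + 2)) x *: orb i)).
rewrite -(prednK (ltnW (ltnW (ltnW hn)))) big_nat_recr // [RHS]big_nat_recl //= addrC.
congr (_ + _); rewrite (prednK (ltnW (ltnW (ltnW hn)))) (orb_n hF eB); congr (_ *: _).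
by apply: fr_eqmod; rewrite hF mulnDr mulnDr muln0 add0n modnMDl.
Qed.

Lemma cyc_inj : injective cyc.
Proof.
move=> x y /(congr1 (coord E (Ordinal (ltnW (ltnW (ltnW hn)))))).
have c0 z : coord E (Ordinal (ltnW (ltnW (ltnW hn)))) (cyc z) = fr (s * 2) z.
  rewrite /cyc; under eq_bigr do rewrite -EE.
  by rewrite coord_sum_free ?(basis_free E_basis).
by rewrite !c0; exact: fmorph_inj.
Qed.

(** Both sides have q ^ n elements, and [cyc] is injective. *)
Lemma cyc_surj (u : V) : (u : restr V) \in S -> exists x, u = cyc x.
Proof.
move=> Su; pose T (x : finvect_type F) : fV := cyc x.
have : [set T x | x : finvect_type F] = [set v : fV | (v : restr V) \in S].
  apply/eqP; rewrite eqEcard; apply/andP; split.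
    by apply/subsetP=> _ /imsetP[x _ ->]; rewrite inE cyc_S.
  rewrite card_vspace_set dimS card_imset; last exact: cyc_inj.
  by rewrite card_ext hF.
by move/setP/(_ u); rewrite inE Su => /imsetP[x _ ->]; exists x.
Qed.

End Parametrization.

Variables (U : {vspace restr (F2 F)}) (h : 'Hom(V, F2 F)) (G Q : {vspace V}) (p : V).
Hypotheses (scU : scattered U)
  (UP : forall Z, points_of U Z <->
          exists x : restr V, [/\ x \in S, x != 0 & Z = <[h x]>%VS])
  (kerh : lker h = G) (dimG : \dim G = (n - 2)%N)
  (GS : forall u : V, (u : restr V) \in S -> u != 0 -> u \notin G)
  (GE : G = (msp e s p (n - 3) + Q)%VS) (dimQ : \dim Q = 1%N)
  (capG : forall X : {vspace V}, (X <= G)%VS -> (X <= imgv (sg e s) G)%VS -> (\dim X <= n - 4)%N)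
  (meetG : ((<[orb e s p (n - 1)]> + <[orb e s p (n - 3)]>) :&: G != 0)%VS).

Let h_neq0 (u : V) : (u : restr V) \in S -> u != 0 -> h u != 0.
Proof. by move=> Su nz_u; rewrite -memv_ker kerh GS. Qed.

Let limgh : limg h = fullv.
Proof.
apply/eqP; rewrite eqEdim subvf dim_F2; have := limg_ker_dim h fullv.
rewrite capfv kerh dimG hV; lia.
Qed.

Let heavy (M : {vspace V}) : (forall u, u \in M -> sg e 1 u \in M) ->
  \dim M = (n - 2)%N -> (n - 3 <= \dim (M :&: G))%N -> False.
Proof.
move=> inv dimM dimMG; have := invariant_dim eB SP inv; rewrite dimM => le_dim.
have : (S :&: restr_vspace M != 0)%VS.
  by rewrite -dimv_eq0 -lt0n; apply: leq_trans le_dim; lia.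
rewrite -vpick0; set m0 := vpick _ => nz_m0.
have := memv_pick (S :&: restr_vspace M)%VS.
rewrite memv_cap mem_restr_vspace -/m0 => /andP[Sm0 Mm0].
have hM : (h @: M = <[h m0]>)%VS.
  apply/esym/eqP; rewrite eqEdim -memvE memv_img // dim_vline h_neq0 //.
  have := limg_ker_dim h M; rewrite kerh dimM; lia.
apply: (no_heavy_point hq hn scU dimS h_neq0 UP Sm0 nz_m0).
  apply: leq_trans le_dim _; apply: dimvS; apply: capvS => //.
  apply/subvP=> u; rewrite !mem_restr_vspace => Mu.
  by rewrite -memv_preim -hM memv_img.
(* If all of S mapped into this point, so would V, which S spans; but the image of [h] has dimension
   2. *)
have [//|no] := pickP (fun u : fV => ((u : restr V) \in S) && (h u \notin <[h m0]>%VS)).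
  by move=> u /andP[]; exists u.
have all1 : (h @^-1: <[h m0]> = fullv)%VS.
  apply: spanS => u Su; rewrite -memv_preim.
  by have := no u; rewrite Su => /negbFE.
have /dimvS : (limg h <= <[h m0]>)%VS.
  by apply/subvP=> _ /memv_imgP[u _ ->]; rewrite memv_preim all1 memvf.
by rewrite limgh dim_F2 dim_vline; case: (_ != 0).
Qed.

Lemma LP_type_of_frame : LP_type n (points_of U).
Proof.
have full := msp_full hn hF hV eB SP co_sn dimG GS GE dimQ capG heavy meetG.
have [a [b [nz_a nz_b Gz]]] :=
  meetG_coef hn hF hV eB co_sn dimG GE dimQ capG meetG.
have Gorb i : (i < n - 3)%N -> h (orb e s p i) = 0.
  move=> lt_i; apply/eqP; rewrite -memv_ker kerh GE.
  by apply: (subvP (addvSl _ _)); apply: orb_msp.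
pose y0 := h (orb e s p (n - 2)); pose y1 := h (orb e s p (n - 3)).
(* Chosen so that [h] kills the vector of G on the line of (iv). *)
pose delta := - (b / a).
have h1 : h (orb e s p (n - 1)) = delta *: y1.
  rewrite -kerh memv_ker linearD !linearZ /= addr_eq0 in Gz.
  by rewrite -[LHS](scalerK nz_a) (eqP Gz) scalerN -scaleNr scalerA mulNr mulrC.
have nEQ : (n = (n - 3).+3)%N by lia.
have hE (c : nat -> F) : h (\sum_(i < n) c i *: orb e s p i) =
    c (n - 2)%N *: y0 + (c (n - 1)%N * delta + c (n - 3)%N) *: y1.
  rewrite -(big_mkord predT (fun i => c i *: orb e s p i)) [X in index_iota 0 X]nEQ.
  rewrite !big_nat_recr //= !linearD !linearZ /= linear_sum big_nat.
  rewrite big1 ?add0r => [|i lt_i]; last by rewrite linearZ /= Gorb ?scaler0.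
  have -> : ((n - 3).+2 = n - 1)%N by lia.
  have -> : ((n - 3).+1 = n - 2)%N by lia.
  by rewrite h1 -/y0 -/y1 scalerA scalerDl addrAC addrC; congr (_ + _); rewrite addrC.
pose Y : 2.-tuple (F2 F) := [tuple y0; y1].
have YB : basis_of fullv Y.
  rewrite basisEdim dim_F2 /= andbT -limgh; apply/subvP=> _ /memv_imgP[u _ ->].
  have : u \in msp e s p n by rewrite full memvf.
  case/memv_sumP=> w wE ->; rewrite linear_sum; apply: memv_suml => i _.
  have /vlineP[c ->] := wE i isT; rewrite linearZ /= memvZ //.
  have Y0 : y0 \in <<Y>>%VS by rewrite memv_span // !inE eqxx.
  have Y1 : y1 \in <<Y>>%VS by rewrite memv_span // !inE eqxx orbT.
  have := ltn_ord i; case: (ltnP i (n - 3)) => [/Gorb-> _|]; first exact: mem0v.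
  rewrite leq_eqVlt => /predU1P[<-|]; first by [].
  rewrite leq_eqVlt => /predU1P[<- _|lt1 lt2].
    by have -> : ((n - 3).+1 = n - 2)%N by lia.
  have -> : (i = n - 1 :> nat)%N by lia.
  by rewrite h1 memvZ.
(* [Ar] maps the standard basis of F^2 to y0, y1, and its inverse [f] is the collineation carrying L
   to the standard LP-type set. *)
pose Ar (v : F2 F) : F2 F := v.1 *: y0 + v.2 *: y1.
pose f (w : F2 F) : F2 F := (coord Y ord0 w, coord Y (lift ord0 ord0) w).
have fK : cancel f Ar.
  by move=> w; rewrite [RHS](coord_basis YB (memvf w)) big_ord_recl big_ord1 /Ar /f.
have ArK : cancel Ar f.
  case=> x y; rewrite /Ar /f.
  have -> : x *: y0 + y *: y1 = \sum_(i < 2) (nth 0 [:: x; y] i) *: Y`_i.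
    by rewrite big_ord_recl big_ord1.
  by rewrite !coord_sum_free ?(basis_free YB).
have hf : semilinear_bij f.
  split; first by exists Ar.
  exists idfun; first by exists idfun.
  by move=> c u v; rewrite /f !linearP.
have frn x : fr (s * (n - 2 + 2)) x = x :> F.
  by rewrite (@fr_eqmod _ _ _ 0) ?fr_id // hF subnK ?modnMl ?mod0n //; lia.
have frs x : fr (s * (n - 1 + 2)) x = fr s x :> F.
  apply: fr_eqmod; rewrite hF; have -> : (s * (n - 1 + 2) = s * n + s)%N by lia.
  by rewrite modnMDl.
have frNs x : fr (s * (n - 3 + 2)) x = fr (n - s) x :> F.
  apply: fr_eqmod; rewrite hF; apply/eqP; rewrite -(eqn_modDr s) subnK; last exact: ltnW.
  have -> : (s * (n - 3 + 2) + s = s * n)%N by nia.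
  by rewrite modnn modnMl.
pose g x := Ar (lp_vec s delta x).
have gE x : h (cyc p x) = g x.
  rewrite /cyc (hE (fun i => fr (s * (i + 2)) x)) frn frs frNs /g /Ar /lp_vec /lp /= hF.
  by rewrite [delta * _]mulrC.
have UPg Z : points_of U Z <-> exists x, [/\ x \in {:F}%VS, x != 0 & Z = <[g x]>%VS].
  rewrite UP; split=> [[u [Su nz_u ->]]|[x [_ nz_x ->]]].
    have [x xE] := cyc_surj full Su; exists x; rewrite memvf -gE xE; split=> //.
    apply: contraNneq nz_u => x0; rewrite xE x0 /cyc big1 // => i _.
    by rewrite rmorph0 scale0r.
  exists (cyc p x); rewrite -gE; split=> //; first exact: cyc_S.
  apply: contraNneq nz_x => E; apply/eqP; apply: (cyc_inj full); rewrite E /cyc.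
  by rewrite big1 // => i _; rewrite rmorph0 scale0r.
have gZ (k : K) x : g (k *: x) = k%:A *: g x.
  by rewrite /g /Ar /lp_vec /= lpZ [k%:A *: _]scalerDr !scalerA !mulr_algl.
have ArZ c v : Ar (c *: v) = c *: Ar v by rewrite /Ar /= scalerDr !scalerA.
have par x y : x != 0 -> y != 0 -> <[g x]>%VS = <[g y]>%VS ->
    x * lp s delta y = y * lp s delta x.
  move=> _ _ E; have /vlineP[c] : g x \in <[g y]>%VS by rewrite -E memv_line.
  rewrite /g -ArZ => /(can_inj ArK) -[-> ->] /=.
  by rewrite -![_ *: _]/(_ * _); ring.
have nz_delta : delta != 0 by rewrite oppr_eq0 mulf_neq0 ?invr_eq0.
have co_s : coprime s (\dim {:F}) by rewrite hF.
have lt_s : (s < \dim {:F})%N by rewrite hF.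
have n_gt2 : (2 < \dim {:F})%N by rewrite hF; lia.
have sc := lp_scattered hq n_gt2 co_s lt_s scU gZ UPg par.
exists s, delta; split=> //.
- rewrite lt_sn andbT lt0n; apply: contraTneq co_sn => ->.
  by rewrite /coprime gcd0n; lia.
- rewrite -hF; apply: scattered_lp_space => x y nz_x nz_y E; apply: sc => //.
  have /vlineP[c cE] : (lp_vec s delta x : F2 F) \in <[lp_vec s delta y : F2 F]>%VS.
    by rewrite -E memv_line.
  apply/eqP; rewrite line_eq; last first.
    apply: contraNneq nz_x => g0; have := congr1 f g0; rewrite /g ArK.
    have -> : f 0 = 0 by rewrite /f !linear0.
    by move/(congr1 fst) => /= ->.
  by rewrite /g cE ArZ memvZ // memv_line.
- exists f => // X; rewrite UPg; split=> [[x [_ nz_x ->]]|[x nz_x]].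
    by exists x => //; apply/(imgv_eq_line _ _ hf fK ArK); rewrite /g /lp_vec /lp hF.
  move/(imgv_eq_line _ _ hf fK ArK) => ->; exists x; split=> //; first exact: memvf.
  by rewrite /g /lp_vec /lp hF.
Qed.

End Backward.

(** * Choice of coordinates avoiding a line *)

(** A linear map with kernel G does not notice projection from G, so the intersection with L need
    never be computed. *)
Lemma projection_image (F : fieldType) (V W : vectType F) (h : 'Hom(V, W))
    (G L : {vspace V}) (u : V) :
  lker h = G -> (\dim G + \dim L)%N = \dim {:V} -> (G :&: L = 0)%VS ->
  (h @: ((G + <[u]>) :&: L) = <[h u]>)%VS.
Proof.
move=> kerh dimGL capGL; have fullGL : (G + L = fullv)%VS.
  by apply/eqP; rewrite eqEdim subvf dimv_disjoint_sum // dimGL leqnn.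
have hG v : v \in G -> h v = 0 by rewrite -kerh memv_ker => /eqP.
apply/eqP; rewrite eqEsubv; apply/andP; split.
  apply/subvP=> _ /memv_imgP[v /memv_capP[/memv_addP[g Gg [_ /vlineP[a ->] ->]] _] ->].
  by rewrite linearD linearZ /= hG // add0r memvZ // memv_line.
have /memv_addP[g Gg [l Ll uE]] : u \in (G + L)%VS by rewrite fullGL memvf.
have -> : h u = h l by rewrite uE linearD /= hG // add0r.
rewrite -memvE memv_img // memv_cap Ll andbT.
have -> : l = - g + u by rewrite uE addKr.
by rewrite memv_add ?memvN ?memv_line.
Qed.

Section ChooseBasis.

Variables (K : finFieldType) (F : fieldExtType K) (V : vectType F) (n : nat).
Hypotheses (hq : (2 < #|K|)%N) (hn : (4 <= n)%N) (hF : \dim {:F} = n).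
Variable e : n.-tuple V.
Hypothesis eB : basis_of fullv e.
Variables (s : nat) (delta : F).
Hypotheses (co_sn : coprime s n) (lt_sn : (0 < s < n)%N) (nz_delta : delta != 0).
Local Notation psi := (lp s delta).

(** As F has dimension n over K, such a family is a K-basis of F. *)
Definition scalar_spanning (a : 'I_n -> F) :=
  forall x : F, exists k : 'I_n -> K, x = \sum_j k j *: a j.

(** Otherwise [psi] minus multiplication by [psi 1] is a vanishing q-polynomial; its coefficient at
    tau is delta, because s differs from 0 and from n - s. *)
Lemma lp_nonscalar : exists x : F, psi x != x * psi 1.
Proof.
case: (pickP (fun x : finvect_type F => psi (x : F) != x * psi 1)) => [x|no]; first by exists x.
have E (x : F) : psi x = x * psi 1 by apply/eqP; move/negbFE: (no x).
have lt_s : (s < n)%N by case/andP: lt_sn.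
have neq_s : (s == n - s)%N = false.
  apply/negP=> /eqP E'; have nE : (n = 2 * s)%N by lia.
  move: co_sn hn; rewrite nE /coprime gcdnMl => /eqP->; lia.
have s0 : (s == 0)%N = false by case: s lt_sn.
pose c (i : nat) : F := (i == s)%:R * delta + (i == n - s)%N%:R * 1 - (i == 0)%N%:R * psi 1.
have := @fr_independent _ F c _ s; rewrite hF /c eqxx neq_s s0 !mul0r mul1r addr0 subr0.
move=> H; case/eqP: nz_delta; apply: H => // x; have := E x; rewrite /lp hF => /eqP.
rewrite -subr_eq0 => /eqP E0; rewrite -[RHS]E0.
under eq_bigr do rewrite mulrBl mulrDl -!mulrA.
rewrite sumrB big_split /= (sum_delta (fun i => delta * fr i x)) //.
rewrite (sum_delta (fun i => 1 * fr i x)); last by lia.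
rewrite (sum_delta (fun i => (delta * fr s 1 + fr (n - s) 1) * fr i x)); last by lia.
by rewrite fr_id mul1r [x * _]mulrC.
Qed.

Lemma spanning_extension (i j : 'I_n) (x : F) : i != j -> x \notin <[1 : F]>%VS ->
  exists a, [/\ scalar_spanning a, a i = 1 & a j = x].
Proof.
move=> neq_ij x1; pose X := (<[1 : F]> + <[x]>)%VS.
have dimX : \dim X = 2%N by rewrite dim_add_line x1 dim_vline oner_neq0.
pose b := [:: 1, x & vbasis X^C].
have sz_b : size b == n.
  by rewrite /= size_tuple dimv_compl dimX hF; apply/eqP; lia.
pose bt := Tuple sz_b.
have spb : (<<bt>> = fullv)%VS.
  by rewrite !span_cons (span_basis (vbasisP _)) addvA -/X addv_complf.
have [o [l [oE lE]]] : exists o l : 'I_n, val o = 0%N /\ val l = 1%N.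
  have lt0 : (0 < n)%N by lia.
  have lt1 : (1 < n)%N by lia.
  by exists (Ordinal lt0), (Ordinal lt1).
have neq_ol : o != l by rewrite -val_eqE oE lE.
(* A permutation moving positions i and j to the first two entries 1 and x of the extended basis. *)
pose r := (tperm i o * tperm (tperm i o j) l)%g.
have ri : r i = o.
  rewrite permM tpermL tpermD //; last by rewrite eq_sym.
  by rewrite -{2}(tpermL i o) (inj_eq perm_inj) eq_sym.
have rj : r j = l by rewrite permM tpermL.
exists (fun k => bt`_(r k)); split; last by rewrite rj lE.
  move=> y; have := @coord_span K F n bt y; rewrite spb memvf => /(_ isT) yE.
  exists (fun k => coord bt (r k) y); rewrite {1}yE.
  by rewrite (reindex_inj (@perm_inj _ r)).
by rewrite ri oE.
Qed.

Variable Lam : {vspace V}.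
Hypothesis dimLam : \dim Lam = 2%N.

Let X (a : 'I_n -> F) (u : V) := \sum_j a j * coord e j u.

(* The determinant of (X a, X (psi a)) on a basis of Lam is polynomial in the
   scalars multiplying a_i and a_j, and its coefficient at the product of both is
   nonzero for a suitable basis a; two nonzero scalars are enough to detect it. *)
Lemma spanning_avoiding : exists a, scalar_spanning a /\
  forall v, v \in Lam -> X a v = 0 -> X (psi \o a) v = 0 -> v = 0.
Proof.
have [u [v [LamE nz_u vu]]] : exists u v, [/\ Lam = (<[u]> + <[v]>)%VS, u != 0 & v \notin <[u]>%VS].
  have bL := vbasisP Lam; set bb := vbasis Lam in bL.
  case: bb bL => -[|u [|v [|w t]]] /= sz bL; move: (sz); rewrite dimLam // => _.
  exists u, v; have := basis_free bL; rewrite free_cons seq1_free => /andP[uv nz_v].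
  have LamE : Lam = (<[u]> + <[v]>)%VS.
    by rewrite -(span_basis bL) span_cons span_seq1.
  have := dimLam; rewrite LamE dim_add_line dim_vline.
  by case: (u != 0) => //; case: (v \notin _).
pose D (a : 'I_n -> F) := X a u * X (psi \o a) v - X a v * X (psi \o a) u.
suff [a [span_a nzD]] : exists a, scalar_spanning a /\ D a != 0.
  exists a; split=> // w; rewrite LamE => /memv_addP[_ /vlineP[al ->] [_ /vlineP[be ->] ->]].
  have XE f : X f (al *: u + be *: v) = al * X f u + be * X f v.
    rewrite /X !mulr_sumr -big_split; apply: eq_bigr => k _.
    by rewrite linearD !linearZ /=; ring.
  rewrite !XE => E1 E2.
  have /eqP : al * D a = 0.
    rewrite -[RHS](subrr 0) -{1}(mul0r (X (psi \o a) v)) -{1}E1 -(mul0r (X a v)) -E2 /D; ring.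
  have /eqP : be * D a = 0.
    rewrite -[RHS](subrr 0) -{1}(mul0r (X a u)) -{1}E2 -(mul0r (X (psi \o a) u)) -E1 /D; ring.
  rewrite !mulf_eq0 (negbTE nzD) !orbF => /eqP-> /eqP->.
  by rewrite !scale0r addr0.
have [i [j nzp]] : exists i j : 'I_n, coord e i u * coord e j v - coord e j u * coord e i v != 0.
  have [i nz_i] : exists i : 'I_n, coord e i u != 0.
    case: (pickP (fun i : 'I_n => coord e i u != 0)) => [i|no]; first by exists i.
    case/eqP: nz_u; apply: (coord_inj eB) => i; rewrite linear0; apply/eqP.
    exact: negbFE (no i).
  exists i; case: (pickP (fun j => coord e i u * coord e j v - coord e j u * coord e i v != 0)).
    by move=> j; exists j.
  move=> no; case/negP: vu; apply/vlineP; exists (coord e i v / coord e i u).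
  apply: (coord_inj eB) => j; rewrite linearZ /=; have /negbFE/eqP/eqP := no j.
  rewrite subr_eq0 => /eqP E; apply: (mulfI nz_i).
  by rewrite E mulrA mulrCA mulfV // mulr1 mulrC.
have neq_ij : i != j.
  by apply: contraNneq nzp => ->; rewrite mulrC subrr.
have [x xP] := lp_nonscalar.
have x1 : x \notin <[1 : F]>%VS.
  apply: contraNN xP => /vlineP[k ->].
  by rewrite lpZ mulr_algl.
have [a [span_a ai aj]] := spanning_extension neq_ij x1.
(* The second nonzero scalar exists because q > 2. *)
have [k nz_k k1] : exists2 k : K, k != 0 & k != 1.
  case: (pickP (fun k : K => (k != 0) && (k != 1))) => [k /andP[]|no]; first by exists k.
  have : (#|K| <= #|[set 0%R; 1%R : K]|)%N.
    apply/subset_leq_card/subsetP=> k _; rewrite !inE.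
    by have := no k; case: (k == 0); case: (k == 1).
  by rewrite cards2; case: (_ != _); lia.
pose sc (t t' : K) (l : 'I_n) : K := if l == i then t else if l == j then t' else 1.
pose at_ t t' l := sc t t' l *: a l.
have span_at t t' : t != 0 -> t' != 0 -> scalar_spanning (at_ t t').
  move=> nz_t nz_t' y; have [c ->] := span_a y.
  exists (fun l => c l / sc t t' l); apply: eq_bigr => l _.
  rewrite /at_ scalerA divfK // /sc; case: (l == i) => //; case: (l == j) => //.
  exact: oner_neq0.
have neq_ji : (j == i) = false by rewrite eq_sym (negbTE neq_ij).
pose C (f : 'I_n -> F) w := \sum_(l | (l != i) && (l != j)) f l * coord e l w.
have XC t t' w : X (at_ t t') w =
    t%:A * coord e i w + (t'%:A * x * coord e j w + C a w).
  rewrite /X (bigD1 i) //= (bigD1 j) //=; last by rewrite eq_sym.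
  rewrite {1 2}/at_ /sc !eqxx neq_ji ai aj -[t' *: x]mulr_algl.
  congr (_ + (_ + _)).
  apply: eq_bigr => l /andP[li lj].
  by rewrite /at_ /sc (negbTE li) (negbTE lj) scale1r.
have PC t t' w : X (psi \o at_ t t') w =
    t%:A * psi 1 * coord e i w + (t'%:A * psi x * coord e j w + C (psi \o a) w).
  rewrite /X (bigD1 i) //= (bigD1 j) //=; last by rewrite eq_sym.
  rewrite {1 2}/at_ /sc !eqxx neq_ji ai aj !lpZ -![_ *: psi _]mulr_algl.
  congr (_ + (_ + _)).
  apply: eq_bigr => l /andP[li lj] /=.
  by rewrite /at_ /sc (negbTE li) (negbTE lj) scale1r.
(* The mixed second difference removes every term free of t or of t', leaving (1 - k)^2 times the
   coefficient of t t'. This is a nonzero Pluecker coordinate of Lam times the factor of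
   [lp_nonscalar]. *)
have diff : D (at_ 1 1) - D (at_ k 1) - D (at_ 1 k) + D (at_ k k) =
    (1 - k%:A) ^+ 2 * (coord e i u * coord e j v - coord e j u * coord e i v) *
    (psi x - x * psi 1).
  rewrite /D !XC !PC scale1r; ring.
have nz_diff : D (at_ 1 1) - D (at_ k 1) - D (at_ 1 k) + D (at_ k k) != 0.
  have nz_1k : 1 - k%:A != 0 :> F.
    rewrite subr_eq0 eq_sym; apply: contraNneq k1 => k1.
    by rewrite -(inj_eq (fmorph_inj (in_alg F))) /= k1 scale1r.
  by rewrite diff !mulf_neq0 ?expf_neq0 // subr_eq0.
have n1 : (1 : K) != 0 := oner_neq0 K.
have [D11|] := eqVneq (D (at_ 1 1)) 0; last by exists (at_ 1 1); split=> //; apply: span_at.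
have [Dk1|] := eqVneq (D (at_ k 1)) 0; last by exists (at_ k 1); split=> //; apply: span_at.
have [D1k|] := eqVneq (D (at_ 1 k)) 0; last by exists (at_ 1 k); split=> //; apply: span_at.
exists (at_ k k); split; first exact: span_at.
by move: nz_diff; rewrite D11 Dk1 D1k !subr0 add0r.
Qed.

End ChooseBasis.

(** * The vertex in cyclic coordinates *)

Section CyclicForms.

Variables (K : finFieldType) (F : fieldExtType K) (V : vectType F) (n : nat).
Hypotheses (hn : (4 <= n)%N) (hF : \dim {:F} = n) (hV : \dim {:V} = n).
Variable e : n.-tuple V.
Hypothesis eB : basis_of fullv e.
Variables (s : nat) (delta : F).
Hypotheses (co_sn : coprime s n) (lt_sn : (0 < s < n)%N) (nz_delta : delta != 0).
Variable a : 'I_n -> F.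
Hypothesis span_a : scalar_spanning (K := K) a.
Local Notation psi := (lp s delta).

(* The shift by 2 makes cform (n - 2), cform (n - 1) and cform (n - 3) the forms
   with coefficients a, a^tau and a^(tau^-1). *)
Definition cform i (u : V) : F := \sum_(j < n) fr (s * (i + 2)) (a j) * coord e j u.

Lemma cformP i c u v : cform i (c *: u + v) = c * cform i u + cform i v.
Proof.
rewrite /cform mulr_sumr -big_split; apply: eq_bigr => j _.
by rewrite linearP /=; ring.
Qed.

Lemma cform0 i : cform i 0 = 0.
Proof. by rewrite /cform big1 // => j _; rewrite linear0 mulr0. Qed.

Lemma cformD i u v : cform i (u + v) = cform i u + cform i v.
Proof. by rewrite -[u]scale1r cformP mul1r scale1r. Qed.

Lemma cformZ i c u : cform i (c *: u) = c * cform i u.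
Proof. by rewrite -[c *: u]addr0 cformP cform0 addr0. Qed.

Lemma cform_sum i I (r : seq I) P (f : I -> V) :
  cform i (\sum_(j <- r | P j) f j) = \sum_(j <- r | P j) cform i (f j).
Proof. exact: (big_morph _ (cformD i) (cform0 i)). Qed.

Lemma cform_sg i k u : cform (i + k) (sg e (s * k) u) = fr (s * k) (cform i u).
Proof.
rewrite /cform rmorph_sum /=; apply: eq_bigr => j _.
rewrite rmorphM /= (coord_sg eB) fr_comp; congr (fr _ _ * _); nia.
Qed.

Lemma cform_mod i j u : i = j %[mod n] -> cform i u = cform j u.
Proof.
move=> ij; apply: eq_bigr => k _; congr (_ * _); apply: fr_eqmod; rewrite hF.
by rewrite -modnMmr -modnDml ij modnDml modnMmr.
Qed.

Let M : 'M[F]_n := \matrix_(i, j) fr (s * (i + 2)) (a j).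

Let MP u (i : 'I_n) : cform i u = (M *m \col_j coord e j u) i 0.
Proof. by rewrite mxE; apply: eq_bigr => j _; rewrite !mxE. Qed.

(** M is a Moore matrix: a relation between its rows is a combination of powers of tau vanishing on
    the K-basis [a], hence on F, hence trivial. *)
Let M_unit : M \in unitmx.
Proof.
rewrite -row_free_unit -kermx_eq0; apply/eqP/row_matrixP=> l; rewrite row0.
set r := row l _; have rM : r *m M = 0 by apply/sub_kermxP; exact: row_sub.
pose c (i : nat) : F := if insub i is Some i' then r 0 i' else 0.
have cE (i : 'I_n) : c i = r 0 i by rewrite /c valK.
have c0 (x : F) : \sum_(i < n) c i * fr (s * (i + 2)) x = 0.
  have [k ->] := span_a x.
  transitivity (\sum_(i < n) \sum_j (k j)%:A * (c i * fr (s * (i + 2)) (a j))).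
    apply: eq_bigr => i _; rewrite rmorph_sum mulr_sumr /=; apply: eq_bigr => j _.
    by rewrite frZ -[k j *: _]mulr_algl; ring.
  rewrite exchange_big big1 //= => j _; rewrite -mulr_sumr.
  have := congr1 (fun A : 'rV[F]_n => A 0 j) rM; rewrite !mxE => E.
  rewrite -[X in _ * X]/(\sum_i _) (eq_bigr (fun i : 'I_n => r 0 i * M i j)) ?E ?mulr0 // => i _.
  by rewrite cE [M i j]mxE.
have co_s : coprime s (\dim {:F}) by rewrite hF.
(* Substituting a conjugate of x undoes the shift by 2 in the exponents. *)
have c0' (x : F) : \sum_(i < \dim {:F}) c i * fr (s * i) x = 0.
  rewrite -[RHS](c0 (fr (s * (n - 2)) x)) hF; apply: eq_bigr => i _; congr (_ * _).
  rewrite fr_comp; apply: fr_eqmod; rewrite hF.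
  have -> : (s * (i + 2) + s * (n - 2) = s * n + s * i)%N by nia.
  by rewrite modnMDl.
apply/rowP=> i; rewrite -cE mxE; apply: (fr_gen_independent co_s c0').
by rewrite hF.
Qed.

Lemma cform_inj u : (forall i, (i < n)%N -> cform i u = 0) -> u = 0.
Proof.
move=> u0; have : M *m (\col_j coord e j u) = 0.
  by apply/colP=> i; rewrite -MP u0 // mxE.
move/(congr1 (mulmx (invmx M))); rewrite mulKmx // mulmx0 => /colP E.
by apply: (coord_inj eB) => j; have := E j; rewrite !mxE linear0.
Qed.

(** This is the vertex point: since the forms are conjugate, the orbit of [p] is the basis dual to
    them, as [cform_orb] shows. *)
Lemma cform_dual : exists p, forall i, (i < n)%N -> cform i p = (i == 0)%N%:R.
Proof.
pose c : 'cV[F]_n := invmx M *m \col_i ((val i == 0)%N%:R).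
exists (\sum_j c j 0 *: e`_j) => i lt_in; rewrite -[i]/(val (Ordinal lt_in)) MP.
have -> : \col_j coord e j (\sum_k c k 0 *: e`_k) = c.
  by apply/colP=> j; rewrite mxE coord_sum_free ?(basis_free eB).
by rewrite mulKVmx // mxE.
Qed.

Section Vertex.

Variable p : V.
Hypothesis pP : forall i, (i < n)%N -> cform i p = (i == 0)%N%:R.
Local Notation orb := (orb e s p).
Local Notation msp := (msp e s p).

Lemma cform_orb i k : (i < n)%N -> (k < n)%N -> cform i (orb k) = (i == k)%:R.
Proof.
move=> lt_i lt_k; have [le_ki|lt_ik] := leqP k i.
  rewrite -{1}(subnK le_ki) cform_sg pP; last by lia.
  by rewrite rmorph_nat subn_eq0; congr (nat_of_bool _)%:R; apply/idP/eqP; lia.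
rewrite (@cform_mod i (i + n - k + k)); last by rewrite subnK ?modnDr //; lia.
rewrite cform_sg pP; last by lia.
by rewrite rmorph_nat; congr (nat_of_bool _)%:R; apply/eqP/eqP; lia.
Qed.

Lemma orb_decomposition u : u = \sum_(i < n) cform i u *: orb i.
Proof.
apply/eqP; rewrite -subr_eq0; apply/eqP; apply: cform_inj => i lt_i.
rewrite cformD -scaleN1r cformZ cform_sum mulN1r.
rewrite (eq_bigr (fun k : 'I_n => (k == i :> nat)%:R * cform k u)) => [|k _].
  by rewrite (sum_delta (fun k => cform k u)) // subrr.
by rewrite cformZ cform_orb // mulrC eq_sym.
Qed.

Lemma msp_n : msp n = fullv.
Proof.
apply/eqP; rewrite eqEsubv subvf; apply/subvP=> u _; rewrite [u]orb_decomposition.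
by apply: memv_suml => i _; rewrite memvZ // orb_msp.
Qed.

Lemma dim_msp k : (k <= n)%N -> \dim (msp k) = k.
Proof.
move=> le_kn; apply/eqP; rewrite eqn_leq dim_msp_le /=.
(* Each orbit vector adds at most one dimension, so to reach V after n steps none may fail to add
   one. *)
have aux l : (\dim (msp (k + l)) <= \dim (msp k) + l)%N.
  elim: l => [|l IHl]; first by rewrite !addn0.
  by rewrite !addnS dim_mspS; case: (_ \notin _); rewrite ?addn1 ?addn0; lia.
by have := aux (n - k)%N; rewrite subnKC // msp_n hV; lia.
Qed.

(** On S the forms are conjugates of one element, and there this map becomes [lp_vec]; see
    [vertex_map_S]. *)
Definition vertex_map (u : V) : F2 F :=
  (cform (n - 2) u, delta * cform (n - 1) u + cform (n - 3) u).

Fact vertex_map_linear : linear vertex_map.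
Proof.
move=> c u v; rewrite /vertex_map !cformP; congr (_, _).
by rewrite /= -[c *: _]/(c * _); ring.
Qed.

HB.instance Definition _ := GRing.isLinear.Build F V (F2 F) _ vertex_map vertex_map_linear.

Definition vertex : {vspace V} := lker (linfun vertex_map).

Lemma mem_vertex u : reflect
  (cform (n - 2) u = 0 /\ delta * cform (n - 1) u + cform (n - 3) u = 0) (u \in vertex).
Proof.
rewrite memv_ker lfunE /= /vertex_map; apply: (iffP eqP) => [[-> ->]|[-> ->]] //.
Qed.

(** This vector spans the point Q of (iii) and also witnesses (iv). *)
Definition vertex_tip : V := orb (n - 1) - delta *: orb (n - 3).

Lemma vertex_tip_in : vertex_tip \in vertex.
Proof.
apply/mem_vertex; rewrite /vertex_tip -scaleNr !cformD !cformZ !cform_orb; try lia.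
have -> : (n - 2 == n - 1)%N = false by apply/eqP; lia.
have -> : (n - 2 == n - 3)%N = false by apply/eqP; lia.
have -> : (n - 1 == n - 3)%N = false by apply/eqP; lia.
have -> : (n - 3 == n - 1)%N = false by apply/eqP; lia.
by rewrite !eqxx /=; split; ring.
Qed.

Lemma vertex_tip_neq0 : vertex_tip != 0.
Proof.
apply/eqP=> /(congr1 (cform (n - 1))); rewrite cform0 /vertex_tip -scaleNr cformD cformZ.
rewrite !cform_orb; try lia.
have -> : (n - 1 == n - 3)%N = false by apply/eqP; lia.
by rewrite eqxx mulr0 addr0 => /eqP; rewrite oner_eq0.
Qed.

Lemma orb_vertex i : (i < n - 3)%N -> orb i \in vertex.
Proof.
move=> lt_i; apply/mem_vertex; rewrite !cform_orb; try lia.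
have -> : (n - 2 == i)%N = false by apply/eqP; lia.
have -> : (n - 1 == i)%N = false by apply/eqP; lia.
have -> : (n - 3 == i)%N = false by apply/eqP; lia.
by rewrite mulr0 addr0.
Qed.

Let nEQ : (n = (n - 3).+3)%N. Proof. by lia. Qed.

Let decomposition3 u : u = \sum_(i < n - 3) cform i u *: orb i + cform (n - 3) u *: orb (n - 3)
  + cform (n - 2) u *: orb (n - 2) + cform (n - 1) u *: orb (n - 1).
Proof.
rewrite {1}[u]orb_decomposition.
rewrite -(big_mkord predT (fun i => cform i u *: orb i)) [X in index_iota 0 X]nEQ.
rewrite !big_nat_recr //= big_mkord.
have -> : ((n - 3).+2 = n - 1)%N by lia.
by have -> : ((n - 3).+1 = n - 2)%N by lia.
Qed.

Lemma vertexE : vertex = (msp (n - 3) + <[vertex_tip]>)%VS.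
Proof.
apply/eqP; rewrite eqEsubv; apply/andP; split; last first.
  rewrite subv_add -memvE vertex_tip_in andbT; apply: msp_subP => i; exact: orb_vertex.
apply/subvP=> u /mem_vertex[u2 u13]; rewrite [u]decomposition3 u2 scale0r addr0 -addrA.
apply: memv_add; first by apply: memv_suml => i _; rewrite memvZ // orb_msp.
apply/vlineP; exists (cform (n - 1) u); rewrite /vertex_tip scalerBr scalerA addrC.
congr (_ + _); rewrite -scaleNr; congr (_ *: _); apply/eqP.
by rewrite -subr_eq0 opprK addrC mulrC u13.
Qed.

(** The equations of the vertex and their shifted conjugates together kill the coordinates with
    indices 0, n - 3, n - 2 and n - 1; the coordinate 0 vanishes because delta is nonzero. *)
Lemma dim_vertex_cap (X : {vspace V}) :
  (X <= vertex)%VS -> (X <= imgv (sg e s) vertex)%VS -> (\dim X <= n - 4)%N.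
Proof.
move=> /subvP X1 /subvP X2.
pose N := (\sum_(i < n - 4) <[orb i.+1]>)%VS.
have dimN : (\dim N <= n - 4)%N.
  have -> : N = imgv (sg e s) (msp (n - 4)) by rewrite imgv_msp.
  by apply: leq_trans (dim_imgv_le _ _) (dim_msp_le _ _ _ _).
apply: leq_trans dimN; apply: dimvS; apply/subvP=> u Xu.
have /mem_vertex[u2 u13] := X1 u Xu.
have /(imgvP _ _ (sg_semilinear1 eB s))[v /mem_vertex[v2 v13] uE] := X2 u Xu.
have shift i : cform i.+1 u = fr s (cform i v).
  by have := cform_sg i 1 v; rewrite muln1 addn1 uE.
have u1 : cform (n - 1) u = 0.
  have -> : (n - 1 = (n - 2).+1)%N by lia.
  by rewrite shift v2 rmorph0.
have u0 : cform 0 u = 0.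
  rewrite (@cform_mod 0 (n - 1).+1); last first.
    by rewrite (_ : (n - 1).+1 = n); [rewrite modnn mod0n | lia].
  have := congr1 (fr s) v13; rewrite rmorphD rmorphM rmorph0 /= -!shift.
  have -> : ((n - 3).+1 = n - 2)%N by lia.
  rewrite u2 addr0 => /eqP; rewrite mulf_eq0 fmorph_eq0 (negbTE nz_delta) /=.
  by move/eqP.
have u3 : cform (n - 3) u = 0 by move: u13; rewrite u1 mulr0 add0r.
rewrite [u]decomposition3 u1 u2 u3 !scale0r !addr0.
rewrite -(big_mkord predT (fun i => cform i u *: orb i)).
have -> : (n - 3 = (n - 4).+1)%N by lia.
rewrite big_nat_recl // u0 scale0r add0r big_mkord.
by apply: memv_suml => i _; rewrite memvZ // memvE (sumv_sup i).
Qed.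

(** The vectors [orb 2], ..., [orb (n - 4)] lie in all three subspaces. *)
Lemma dim_vertex_cap3 (X : {vspace V}) :
  (forall u, u \in vertex -> u \in imgv (sg e s) vertex ->
     u \in imgv (sg e (s * 2)) vertex -> u \in X) -> (n - 5 <= \dim X)%N.
Proof.
move=> HX; have sl1 := sg_semilinear1 eB s; have sl2 := sg_semilinear1 eB (s * 2).
pose N := imgv (sg e (s * 2)) (msp (n - 5)).
have dimN : \dim N = (n - 5)%N by rewrite (dim_imgv _ sl2) dim_msp //; lia.
rewrite -dimN; apply: dimvS; rewrite /N /msp (imgv_sum _ _ sl2); apply/subv_sumP=> i _.
rewrite (imgv_line _ sl2) -memvE.
have E2 : sg e (s * 2) (orb i) = orb (i + 2).
  by rewrite /orb (sg_comp eB); congr (sg _ _ _); nia.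
have lt_i := ltn_ord i; apply: HX.
- by rewrite E2 orb_vertex //; lia.
- rewrite E2 addn2 -(sg_orb eB) mem_imgv // orb_vertex //; lia.
- by rewrite mem_imgv // orb_vertex //; lia.
Qed.

(** The first equation, at the successive conjugates of [p'], kills its coordinates 2, ..., n - 2.
    The second then kills coordinate n - 1 at the first conjugate and coordinate 1 at the last one;
    there n > 4 is used, so that coordinate 3 is among those already killed. *)
Lemma vertex_unique p' : (4 < n)%N ->
  (forall i, (i < n - 3)%N -> sg e (s * i) p' \in vertex) -> p' \in <[p]>%VS.
Proof.
move=> n4 Hp.
have shift i k : cform (i + k) (sg e (s * k) p') = fr (s * k) (cform i p') := cform_sg i k p'.
have low k : (k < n - 3)%N -> cform (n - 2 - k) p' = 0.
  move=> lt_k; have /mem_vertex[H _] := Hp k lt_k.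
  have := shift (n - 2 - k)%N k; rewrite subnK; last by lia.
  by rewrite H => /esym/eqP; rewrite fmorph_eq0 => /eqP.
have mid i : (1 < i < n - 1)%N -> cform i p' = 0.
  move=> /andP[i1 i2]; have -> : (i = n - 2 - (n - 2 - i))%N by lia.
  by apply: low; lia.
have top : cform (n - 1) p' = 0.
  have n30 : (0 < n - 3)%N by lia.
  have := Hp 0%N n30; rewrite muln0 (sg_id eB) => /mem_vertex[_].
  rewrite (mid (n - 3)%N); last by lia.
  by move/eqP; rewrite addr0 mulf_eq0 (negbTE nz_delta) => /eqP.
have bot : cform 1 p' = 0.
  have n34 : (n - 4 < n - 3)%N by lia.
  have /mem_vertex[_] := Hp _ n34.
  have -> : (n - 1 = 3 + (n - 4))%N by lia.
  have -> : (n - 3 = 1 + (n - 4))%N by lia.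
  rewrite !shift (mid 3); last by lia.
  by rewrite rmorph0 mulr0 add0r => /eqP; rewrite fmorph_eq0 => /eqP.
apply/vlineP; exists (cform 0 p'); rewrite {1}[p']orb_decomposition.
have n0 : (0 < n)%N by lia.
rewrite (bigD1 (Ordinal n0)) //= big1 ?addr0 => [|i i0].
  by rewrite /orb muln0 (sg_id eB).
have : (0 < i)%N by rewrite lt0n; move: i0; rewrite -val_eqE.
have := ltn_ord i; case: (nat_of_ord i) => [|[|k]] // lt_k _; first by rewrite bot scale0r.
have [->|ne] := eqVneq k.+2 (n - 1)%N; first by rewrite top scale0r.
by rewrite mid ?scale0r //; lia.
Qed.

Lemma vertex_tip_line :
  vertex_tip \in ((<[orb (n - 1)]> + <[orb (n - 3)]>) :&: vertex)%VS.
Proof.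
rewrite memv_cap vertex_tip_in andbT /vertex_tip memv_add ?memv_line //.
by rewrite memvN memvZ // memv_line.
Qed.

End Vertex.

Lemma vertex_map_S (u : V) : sg e 1 u = u ->
  vertex_map u = lp_vec s delta (cform (n - 2) u).
Proof.
move=> fu; have fs j : sg e j u = u := sg_fixed eB j fu.
have shift i : cform i.+1 u = fr s (cform i u).
  by have := cform_sg i 1 u; rewrite muln1 addn1 fs.
rewrite /vertex_map /lp_vec /lp; congr (_, delta * _ + _).
  by rewrite -shift; congr cform; lia.
have := shift (n - 3)%N; have -> : ((n - 3).+1 = n - 2)%N by lia.
move=> ->; rewrite fr_comp hF subnK ?(ltnW (proj2 (andP lt_sn))) //.
by rewrite -[in fr n]hF fr_dim.
Qed.

Lemma cform_S_inj (u : V) : sg e 1 u = u -> cform (n - 2) u = 0 -> u = 0.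
Proof.
move=> fu u0; have fs j : sg e j u = u := sg_fixed eB j fu.
have shift i k : cform (i + k) u = fr (s * k) (cform i u).
  by have := cform_sg i k u; rewrite fs.
apply: cform_inj => i lt_i; rewrite (@cform_mod i (n - 2 + (i + 2))).
  by rewrite shift u0 rmorph0.
by rewrite (_ : n - 2 + (i + 2) = i + n)%N ?modnDr //; lia.
Qed.

Lemma cform_base u : cform (n - 2) u = \sum_j a j * coord e j u.
Proof.
apply: eq_bigr => j _; rewrite subnK; last by lia.
by rewrite (@fr_eqmod _ _ _ 0) ?fr_id // hF modnMl mod0n.
Qed.

Lemma cform_S_surj x : exists2 u : V, sg e 1 u = u & cform (n - 2) u = x.
Proof.
have [k ->] := span_a x; exists (\sum_j (k j)%:A *: e`_j).
  apply: (coord_inj eB) => j; rewrite (coord_sg eB) coord_sum_free ?(basis_free eB) //.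
  exact: fr_alg.
rewrite cform_base; apply: eq_bigr => j _.
by rewrite coord_sum_free ?(basis_free eB) // mulr_algr.
Qed.

Lemma vertex_map_psi u : vertex_map u =
  (\sum_j a j * coord e j u, \sum_j (psi \o a) j * coord e j u) :> F2 F.
Proof.
rewrite /vertex_map cform_base; congr (_, _).
rewrite /cform mulr_sumr -big_split; apply: eq_bigr => j _ /=.
rewrite mulrA -mulrDl /lp hF; congr ((_ * _ + _) * _); apply: fr_eqmod; rewrite hF.
  have -> : (s * (n - 1 + 2) = s * n + s)%N by nia.
  by rewrite modnMDl.
have lt_s : (s < n)%N by case/andP: lt_sn.
apply/eqP; rewrite -(eqn_modDr s) subnK; last exact: ltnW.
have -> : (s * (n - 3 + 2) + s = s * n)%N by nia.
by rewrite modnn modnMl.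
Qed.

End CyclicForms.

(** * The characterization *)

Lemma subgeometryP (K : finFieldType) (F : fieldExtType K) (V : vectType F) n
    (Sigma : {vspace V} -> Prop) :
  \dim {:V} = n -> canonical_subgeometry Sigma ->
  exists (S : {vspace restr V}) (e : n.-tuple V),
    [/\ \dim S = n, basis_of fullv e,
        forall W : {vspace V}, (forall u : V, (u : restr V) \in S -> u \in W) -> W = fullv,
        forall u : V, (u : restr V) \in S <-> sg e 1 u = u
      & forall X, Sigma X <-> exists u, [/\ u != 0, sg e 1 u = u & X = <[u]>%VS]].
Proof.
move=> hV [S [dimS spanS SigmaP]]; have nE : \dim S = n by rewrite dimS.
have [e [eB SP]] : exists e : n.-tuple V, basis_of fullv e /\
    forall u : V, (u : restr V) \in S <-> sg e 1 u = u.
  by rewrite -nE; apply: subgeometry_basis.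
exists S, e; split=> // X; rewrite SigmaP; split=> -[u].
  by case=> Su nz_u ->; exists u; split=> //; apply/SP.
by case=> nz_u fu ->; exists u; split=> //; apply/SP.
Qed.

Lemma iter_imgv1 (K : finFieldType) (F : fieldExtType K) (V : vectType F) m (e : m.-tuple V)
    (sigma : V -> V) s lam k X :
  basis_of fullv e -> lam != 0 -> (sigma =1 fun u => lam *: sg e s u) ->
  iter k (imgv sigma) X = imgv (sg e (s * k)) X.
Proof.
move=> eB nz_lam sE; rewrite -(iter_imgv eB s k X nz_lam).
by elim: k => //= k ->; apply: eq_imgv.
Qed.

(** The two inequalities say that r = 1 fails and r = 2 succeeds. For n = 4 the difference n - 5
    truncates to 0, rightly, as the condition for r = 2 is then empty. *)
Lemma intn2P (F : fieldType) (V : vectType F) (sigma : V -> V) (G : {vspace V}) n :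
  (4 <= n)%N -> \dim G = (n - 2)%N ->
  intn sigma G = 2%N <->
  (\dim (G :&: imgv sigma G) <= n - 4)%N /\
  (n - 5 <= \dim (\bigcap_(i < 3) iter i (imgv sigma) G))%N.
Proof.
move=> hn dimG.
have c1E : intn_cond sigma G 1 = (n - 4 < \dim (G :&: imgv sigma G))%N.
  rewrite /intn_cond /= /pdim dimG 2!big_ord_recl big_ord0 capvf /=; lia.
have c2E : intn_cond sigma G 2 = (n - 5 <= \dim (\bigcap_(i < 3) iter i (imgv sigma) G))%N.
  rewrite /intn_cond /= /pdim dimG; lia.
rewrite /intn; case: ex_minnP => r cr min_r; split=> [r2|[c1 c2]].
  rewrite r2 in cr min_r; split; last by rewrite -c2E.
  by rewrite leqNgt -c1E; apply/negP=> /min_r.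
have r_le2 : (r <= 2)%N by apply: min_r; rewrite c2E.
case: r cr {min_r} r_le2 => [|[|[|]]] //.
by rewrite c1E ltnNge c1.
Qed.

Lemma dim1_line (F : fieldType) (V : vectType F) (P : {vspace V}) :
  \dim P = 1%N -> exists2 p, p != 0 & P = <[p]>%VS.
Proof.
move=> dimP; have nz : vpick P != 0 by rewrite vpick0 -dimv_eq0 dimP.
exists (vpick P) => //; apply/esym/eqP.
by rewrite eqEdim -memvE memv_pick dim_vline nz dimP.
Qed.

(* The automorphism of F attached to an equivalence can be absorbed into delta. *)
Lemma LP_type_linear (K : finFieldType) (F : fieldExtType K) n (L : {vspace F2 F} -> Prop) :
  \dim {:F} = n -> LP_type n L ->
  exists s delta (A : 'Hom(F2 F, F2 F)),
    [/\ (0 < s < n)%N, coprime s n, delta != 0, lker A == 0%VS &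
        forall X, L X <-> exists2 x, x != 0 & X = <[A (lp_vec s delta x)]>%VS].
Proof.
move=> hF [s [delta [lt_s co_sn nz_delta _ [f hf LP]]]].
have [[g fK gK] [rho [t rhoK tK] fP]] := hf.
(* The inverse [g] of [f] is semilinear for the inverse of rho, so composing it with the
   coordinatewise rho gives a linear map; rho commutes with the powers of q and only moves delta. *)
pose rho2 (v : F2 F) : F2 F := (rho v.1, rho v.2).
pose A (v : F2 F) : F2 F := g (rho2 v).
have Alin : linear A.
  move=> c u v; apply: (can_inj fK); rewrite fP /A !gK /rho2.
  by congr (_, _); rewrite /= rmorphD; congr (_ + _); exact: rmorphM.
pose AL := GRing.isLinear.Build F (F2 F) (F2 F) _ A Alin.
pose A' : {linear F2 F -> F2 F} := HB.pack A AL.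
have t0 : t delta != 0.
  by apply: contraNneq nz_delta => td0; rewrite -[delta]tK td0 rmorph0.
exists s, (t delta), (linfun A'); split=> //.
  apply/lker0P => u v; rewrite !lfunE /= /A => /(can_inj gK) [].
  by case: u v => [u1 u2] [v1 v2] /= /(can_inj rhoK)-> /(can_inj rhoK)->.
have key y : g (rho y, delta * rho y ^+ (#|K| ^ s) + rho y ^+ (#|K| ^ (n - s))) =
    linfun A' (lp_vec s (t delta) y).
  rewrite lfunE /= /A /rho2 /lp_vec /lp /fr hF /=; congr (g (_, _)).
  by rewrite rmorphD rmorphM !rmorphXn /= tK.
move=> X; rewrite LP; split=> [[x nz_x]|[y nz_y ->]].
  move/(imgv_eq_line _ _ hf fK gK) => ->; exists (t x).
    by apply: contraNneq nz_x => tx0; rewrite -[x]tK tx0 rmorph0.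
  by rewrite -key tK.
exists (rho y); first by rewrite fmorph_eq0.
by apply/(imgv_eq_line _ _ hf fK gK); rewrite key.
Qed.

Theorem theorem3p2 (K : finFieldType) (F : fieldExtType K) (V : vectType F)
    (n : nat) (Sigma : {vspace V} -> Prop) (Lam : {vspace V})
    (L : {vspace F2 F} -> Prop)
    (hq : (2 < #|K|)%N) (hn : (4 <= n)%N)
    (hF : \dim {:F} = n) (hV : \dim {:V} = n)
    (hSigma : canonical_subgeometry Sigma)
    (hLam : \dim Lam = 2%N)
    (hL : scattered_linear_set L) :
  LP_type n L <->
  exists Gam : {vspace V},
    [/\ \dim Gam = (n - 2)%N,
        forall X : {vspace V}, Sigma X -> ~~ (X <= Gam)%VS,
        (Gam :&: Lam = 0)%VS,
        (* L = p_{Gam,Lam}(Sigma) under an identification of Lam with PG(1,q^n) *)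
        exists2 iota : 'Hom(V, F2 F), (Lam :&: lker iota = 0)%VS &
          forall Z : {vspace F2 F},
            L Z <-> exists2 Y, projection Gam Lam Sigma Y & Z = (iota @: Y)%VS
      & exists sigma : V -> V,
          [/\ stabilizer_generator Sigma sigma,
              intn sigma Gam = 2%N
            & exists P : {vspace V},
                [/\ \dim P = 1%N,
                    spanned_from n sigma Gam P,
                    (* uniqueness of P; for n = 4, spanned_from holds for every
                       point of the line Gam *)
                    (4 < n)%N -> forall P' : {vspace V}, \dim P' = 1%N ->
                      spanned_from n sigma Gam P' -> P' = P
                  & ((iter (n - 1) (imgv sigma) P
                       + iter (n - 3) (imgv sigma) P) :&: Gam != 0)%VS]]].
Proof.
have [S [e [dimS eB spanS SP SigmaP]]] := subgeometryP hV hSigma.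
have n_gt1 : (1 < n)%N by lia.
have dimGL (G : {vspace V}) : \dim G = (n - 2)%N -> (\dim G + \dim Lam)%N = \dim {:V}.
  by move=> ->; rewrite hLam hV; lia.
split=> [hLP|[Gam [dimG GS capGL [iota capI LP]]]]; last first.
  case=> sigma [gen intn2 [P [dimP spP _ meet]]].
  have [s [lam [lt_s co_s nz_lam sigmaE]]] := stabilizer_generatorP eB SigmaP n_gt1 gen.
  rewrite hF in lt_s co_s.
  have itE k X : iter k (imgv sigma) X = imgv (sg e (s * k)) X.
    exact: iter_imgv1 eB nz_lam sigmaE.
  have [p nz_p PE] := dim1_line dimP.
  have orbE k : iter k (imgv sigma) P = <[orb e s p k]>%VS.
    by rewrite itE PE (imgv_line _ (sg_semilinear1 eB _)).
  have [Q dimQ GE] := spP.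
  have {}GE : Gam = (msp e s p (n - 3) + Q)%VS.
    by rewrite {1}GE; congr (_ + _)%VS; apply: eq_bigr => i _; rewrite orbE.
  have [cap1 _] := (intn2P sigma hn dimG).1 intn2.
  have capG (X : {vspace V}) : (X <= Gam)%VS -> (X <= imgv (sg e s) Gam)%VS -> (\dim X <= n - 4)%N.
    move=> X1 X2; apply: leq_trans cap1; apply: dimvS; rewrite subv_cap X1.
    by have := itE 1%N Gam; rewrite /= muln1 => ->.
  have GS' (u : V) : (u : restr V) \in S -> u != 0 -> u \notin Gam.
    by move=> /SP fu nz_u; rewrite memvE GS //; apply/SigmaP; exists u.
  have fullLG : (Lam + Gam = fullv)%VS.
    by apply/eqP; rewrite addvC eqEdim subvf dimv_disjoint_sum // (dimGL _ dimG) leqnn.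
  (* Projection onto Lam along Gam followed by [iota]: a map with kernel Gam that agrees with [iota]
     on Lam. *)
  pose h := (iota \o daddv_pi Lam Gam)%VF.
  have capLG : (Lam :&: Gam = 0)%VS by rewrite capvC.
  have kerh : lker h = Gam.
    apply/vspaceP=> u; rewrite memv_ker comp_lfunE /=.
    have uLG : u \in (Lam + Gam)%VS by rewrite fullLG memvf.
    have uE := daddv_pi_add capLG uLG; set v := daddv_pi Lam Gam u in uE *.
    have Lv : v \in Lam := memv_pi _ _ _.
    apply/eqP/idP=> [iv|Gu].
      have : v \in (Lam :&: lker iota)%VS by rewrite memv_cap Lv memv_ker iv eqxx.
      rewrite capI memv0 => /eqP v0; rewrite -uE v0 add0r; exact: memv_pi.
    have : v \in (Lam :&: Gam)%VS.
      rewrite memv_cap Lv; have -> : v = u - daddv_pi Gam Lam u by rewrite -{1}uE addrK.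
      by rewrite memvB // memv_pi.
    by rewrite capLG memv0 => /eqP->; rewrite linear0.
  have [U scU LU] := hL.
  have hproj (u : V) : (iota @: ((Gam + <[u]>) :&: Lam) = <[h u]>)%VS.
    rewrite -(projection_image u kerh (dimGL _ dimG) capGL); apply: eq_in_limg => v.
    by case/memv_capP=> _ Lv; rewrite comp_lfunE /= daddv_pi_id.
  have UP Z : points_of U Z <-> exists x : restr V, [/\ x \in S, x != 0 & Z = <[h x]>%VS].
    rewrite -LU LP; split=> [[_ [X /SigmaP[u [nz_u fu ->]] ->] ->]|[u [Su nz_u ->]]].
      by exists u; rewrite hproj; split=> //; apply/SP.
    exists ((Gam + <[u : V]>) :&: Lam)%VS; last by rewrite hproj.
    by exists <[u : V]>%VS => //; apply/SigmaP; exists u; split=> //; apply/SP.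
  have meetG : ((<[orb e s p (n - 1)]> + <[orb e s p (n - 3)]>) :&: Gam != 0)%VS.
    by rewrite -!orbE.
  have := LP_type_of_frame hq hn hF hV eB SP dimS spanS co_s lt_s scU UP kerh dimG GS' GE dimQ capG meetG.
  case=> s' [d' [h1 h2 h3 h4 [f hf fLP]]]; exists s', d'; split=> //.
  by exists f => // X; rewrite LU.
have [s [delta [A [lt_s co_s nz_delta kerA LA]]]] := LP_type_linear hF hLP.
have [a [span_a avoid]] := spanning_avoiding hq hn hF eB co_s lt_s nz_delta hLam.
have [p pP] := cform_dual hn hF hV eB co_s lt_s nz_delta span_a.
pose Gam := vertex e s delta a.
have sl j := sg_semilinear1 eB j.
have itE k X : iter k (imgv (sg e s)) X = imgv (sg e (s * k)) X.
  by apply: iter_imgv1 eB (oner_neq0 F) _ => u; rewrite scale1r.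
have orbE k u : iter k (imgv (sg e s)) <[u]>%VS = <[sg e (s * k) u]>%VS.
  by rewrite itE (imgv_line _ (sl _)).
pose phi := linfun (vertex_map e s delta a).
have kerphi : lker phi = Gam by [].
have capGL : (Gam :&: Lam = 0)%VS.
  apply/eqP; rewrite -subv0; apply/subvP=> v /memv_capP[Gv Lv]; rewrite memv0; apply/eqP.
  move: Gv; rewrite memv_ker lfunE /= (vertex_map_psi hn hF hV eB co_s lt_s nz_delta span_a) => /eqP[E1 E2].
  exact: avoid.
have dimG : \dim Gam = (n - 2)%N.
  have := limg_ker_dim phi fullv; rewrite capfv kerphi hV.
  suff -> : \dim (limg phi) = 2%N by lia.
  apply/eqP; rewrite eqn_leq -{1}(dim_F2 F) dimvS ?subvf //=.
  rewrite -hLam -(limg_dim_eq (f := phi) (U := Lam)) ?dimvS ?limgS ?subvf //.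
  by rewrite kerphi capvC.
exists Gam; split=> //.
- move=> X /SigmaP[u [nz_u fu ->]]; rewrite -memvE; apply/negP.
  move=> /mem_vertex[u0 _]; case/eqP: nz_u.
  exact: (cform_S_inj hn hF hV eB co_s lt_s nz_delta span_a fu).
(* The vertex being skew to Lam, [phi] restricts to a bijection from Lam to F^2; composing with [A]
   corrects for the position of L. *)
- exists (A \o phi)%VF.
    apply/eqP; rewrite -subv0; apply/subvP=> v /memv_capP[Lv].
    rewrite memv_ker comp_lfunE => /eqP Av.
    have : v \in (Gam :&: Lam)%VS.
      rewrite memv_cap Lv andbT -kerphi memv_ker; apply/eqP.
      by have /lker0P injA := kerA; apply: injA; rewrite Av linear0.
    by rewrite capGL.
  have projE (u : V) : sg e 1 u = u -> ((A \o phi) @: ((Gam + <[u]>) :&: Lam))%VS =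
      <[A (lp_vec s delta (cform e s a (n - 2) u))]>%VS.
    move=> fu; rewrite limg_comp (projection_image u kerphi (dimGL _ dimG) capGL) limg_line.
    by rewrite lfunE /= (vertex_map_S hn hF hV eB co_s lt_s nz_delta span_a fu).
  move=> Z; rewrite LA; split=> [[x nz_x ->]|[_ [X /SigmaP[u [nz_u fu ->]] ->] ->]].
    have [u fu ux] := cform_S_surj hn hF hV eB co_s lt_s nz_delta span_a x.
    exists ((Gam + <[u]>) :&: Lam)%VS; last by rewrite projE // ux.
    exists <[u]>%VS => //; apply/SigmaP; exists u; split=> //.
    by apply: contraNneq nz_x => u0; rewrite -ux u0 cform0.
  rewrite projE //; exists (cform e s a (n - 2) u) => //.
  by apply: contraNneq nz_u => /(cform_S_inj hn hF hV eB co_s lt_s nz_delta span_a fu)->.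
exists (sg e s); split.
- by apply: (sg_stabilizer_generator eB SigmaP n_gt1); rewrite hF.
- apply/(intn2P _ hn dimG); split.
    by apply: (dim_vertex_cap hn hF hV eB co_s lt_s nz_delta span_a pP); rewrite ?capvSl ?capvSr.
  apply: (dim_vertex_cap3 hn hF hV eB co_s lt_s nz_delta span_a pP) => u u0 u1 u2.
  rewrite !big_ord_recl big_ord0 capvf !memv_cap u0 /= u1.
  by have := itE 2%N Gam; rewrite /= => ->.
exists <[p]>%VS; split.
- rewrite dim_vline; have -> // : p != 0.
  apply/eqP=> p0; have n0 : (0 < n)%N by lia.
  by have := pP 0%N n0; rewrite p0 cform0 => /esym/eqP; rewrite oner_eq0.
- exists <[vertex_tip e s delta p]>%VS.
    by rewrite dim_vline (vertex_tip_neq0 hn hF hV eB co_s lt_s nz_delta span_a pP).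
  rewrite /Gam (vertexE hn hF hV eB co_s lt_s nz_delta span_a pP); congr (_ + _)%VS.
  by apply: eq_bigr => i _; rewrite orbE.
- move=> n4 P' dimP' [Q' _ GE']; have [p' nz_p' P'E] := dim1_line dimP'.
  have pp' : p' \in <[p]>%VS.
    apply: (vertex_unique hn hF hV eB co_s lt_s nz_delta span_a pP n4) => i lt_i.
    rewrite -/Gam GE'; apply: (subvP (addvSl _ _)).
    rewrite memvE -orbE -P'E; exact: (sumv_sup (Ordinal lt_i)).
  by rewrite P'E; apply/eqP; rewrite line_eq.
rewrite !orbE; apply/eqP=> cap0.
have : vertex_tip e s delta p \in (0 : {vspace V})%VS.
  by rewrite -cap0; apply: (vertex_tip_line hn hF hV eB co_s lt_s nz_delta span_a pP).
by rewrite memv0 (negbTE (vertex_tip_neq0 hn hF hV eB co_s lt_s nz_delta span_a pP)).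
Qed.
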